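(* Let $\beta_1,\beta_2,\gamma_1,\gamma_2\in\mathbb{C}$ with $\beta_1\neq\beta_2$. With respect to the actual fundamental matrices $\Phi_0^\theta(x,0)$ at the origin, the initial equation has one singular direction at the origin, $\theta=\arg(\beta_1-\beta_2)$, and the corresponding Stokes matrix is $$St_0^\theta=\begin{pmatrix}1&-2\pi i(\gamma_2-\gamma_1)S\\0&1\end{pmatrix},\qquad S=\sum_{n=0}^\infty\frac{(-1)^{n+1}(\gamma_2-\gamma_1)^n(\beta_2-\beta_1)^n}{n!\,(n+1)!}.$$
   Context: Initial equation: $L_2(L_1 y)=0$ with $L_1=\partial-\left(\frac{\beta_1}{x^2}+\gamma_1\right)$, $L_2=\partial-\left(-\frac{2}{x}+\frac{\beta_2}{x^2}+\gamma_2\right)$, $\partial=\frac{d}{dx}$. A fundamental matrix of it means a matrix $\begin{pmatrix}\Phi_1&\Phi_{12}\\0&\Phi_2\end{pmatrix}$ with $L_1\Phi_1=0$, $L_2\Phi_2=0$, $L_1\Phi_{12}=\Phi_2$ and $\Phi_1,\Phi_2\not\equiv0$. Put $G=\mathrm{diag}(\gamma_1,\gamma_2)$, $\Lambda=\mathrm{diag}(0,-2)$, $B=\mathrm{diag}(\beta_1,\beta_2)$. For a direction $\theta\neq\arg(\beta_1-\beta_2)$ (mod $2\pi$) the actual fundamental matrix at the origin is $$\Phi_0^\theta(x,0)=e^{Gx}H_\theta(x)\,x^{\Lambda}e^{-B/x},\quad H_\theta(x)=\begin{pmatrix}1&\frac{x^2}{\beta_2-\beta_1}+(\gamma_2-\gamma_1)x^2\phi_\theta(x)\\0&1\end{pmatrix},$$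 $\phi_\theta(x)=\int_0^{+\infty e^{i\theta}}\frac{u(\zeta)e^{-\zeta/x}}{\zeta+\beta_2-\beta_1}\,d\zeta$, $u(\zeta)=\sum_{k\ge0}\frac{(\gamma_2-\gamma_1)^k}{k!(k+1)!}\zeta^k$, defined for $\mathrm{Re}(e^{i\theta}/x)>|\gamma_2-\gamma_1|$. A direction is singular at the origin if the denominator $\zeta+\beta_2-\beta_1$ of this Laplace integral vanishes on the ray $\arg\zeta=\theta$. (When $S=0$ or $\gamma_1=\gamma_2$ the matrices $H_\theta$ agree for all $\theta$; the direction $\arg(\beta_1-\beta_2)$ is still listed, with Stokes matrix given by the same formula.) For a singular direction $\theta$ the Stokes matrix is $St_0^\theta=(\Phi_0^{\theta+\epsilon}(x,0))^{-1}\Phi_0^{\theta-\epsilon}(x,0)$, for small $\epsilon>0$ and $x$ in the common domain of definition. *)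

(* Defs.v *)
From Stdlib Require Import Reals ZArith.
From Coquelicot Require Import Coquelicot.

Open Scope R_scope.

(** * Complex numbers *)

Definition Cexp (z : C) : C :=
  (exp (Re z) * cos (Im z), exp (Re z) * sin (Im z)).

(** Principal argument, in (-PI, PI]; only meaningful for [z <> 0]. *)
Definition Arg (z : C) : R :=
  if Rle_dec 0 (Im z) then acos (Re z / Cmod z) else - acos (Re z / Cmod z).

Definition CSeries (a : nat -> C) : C :=
  (Series (fun n => Re (a n)), Series (fun n => Im (a n))).

(** Integral of [f] along the ray from 0 to infinity in direction [theta],
    parametrized by [zeta = t * e^(i theta)]. *)
Definition ray_int (theta : R) (f : C -> C) : C :=
  RInt_gen (V := C_R_CompleteNormedModule)
    (fun t : R => f (RtoC t * Cexp (Ci * RtoC theta)) * Cexp (Ci * RtoC theta))%C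
    (at_point 0) (Rbar_locally p_infty).

(** * 2 x 2 complex matrices *)

Definition M2 (a b c d : C) : matrix (T := C) 2 2 :=
  mk_matrix 2 2 (fun i j =>
    match i, j with
    | O, O => a
    | O, _ => b
    | _, O => c
    | _, _ => d
    end).

Definition diag2 (a d : C) : matrix (T := C) 2 2 := M2 a (RtoC 0) (RtoC 0) d.

Definition mul2 (A B : matrix (T := C) 2 2) : matrix (T := C) 2 2 :=
  Mmult (T := C_Ring) A B.

Definition is_inv2 (A N : matrix (T := C) 2 2) : Prop :=
  mul2 A N = Mone (T := C_Ring) /\ mul2 N A = Mone (T := C_Ring).

(** * The equation L2 (L1 y) = 0 *)

(** [(d/dx - a) y = v] at the point [x], with a complex derivative. *)
Definition is_Lop (a y : C -> C) (x v : C) : Prop :=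
  exists dy : C,
    is_derive (K := C_AbsRing) (V := C_NormedModule) y x dy /\
    (dy - a x * y x)%C = v.

Definition coefL1 (beta1 gamma1 : C) (x : C) : C :=
  (beta1 / x ^ 2 + gamma1)%C.

Definition coefL2 (beta2 gamma2 : C) (x : C) : C :=
  (- RtoC 2 / x + beta2 / x ^ 2 + gamma2)%C.

Definition is_fundamental_matrix (beta1 beta2 gamma1 gamma2 : C)
    (D : C -> Prop) (Phi : C -> matrix (T := C) 2 2) : Prop :=
  let L1 := is_Lop (coefL1 beta1 gamma1) in
  let L2 := is_Lop (coefL2 beta2 gamma2) in
  let Phi1 := fun x => coeff_mat (RtoC 0) (Phi x) 0 0 in
  let Phi12 := fun x => coeff_mat (RtoC 0) (Phi x) 0 1 in
  let Phi21 := fun x => coeff_mat (RtoC 0) (Phi x) 1 0 in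
  let Phi2 := fun x => coeff_mat (RtoC 0) (Phi x) 1 1 in
  (forall x, D x ->
     Phi21 x = RtoC 0 /\
     L1 Phi1 x (RtoC 0) /\
     L2 Phi2 x (RtoC 0) /\
     L1 Phi12 x (Phi2 x)) /\
  (exists x, D x /\ Phi1 x <> RtoC 0) /\
  (exists x, D x /\ Phi2 x <> RtoC 0).

(** * Actual fundamental matrices at the origin *)

Definition laplace_u (gamma1 gamma2 zeta : C) : C :=
  CSeries (fun k =>
    (gamma2 - gamma1) ^ k / RtoC (INR (fact k) * INR (fact (k + 1)))
      * zeta ^ k)%C.

Definition laplace_den (beta1 beta2 zeta : C) : C :=
  (zeta + beta2 - beta1)%C.

Definition phi0 (beta1 beta2 gamma1 gamma2 : C) (theta : R) (x : C) : C :=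
  ray_int theta (fun zeta =>
    laplace_u gamma1 gamma2 zeta * Cexp (- (zeta / x))
      / laplace_den beta1 beta2 zeta)%C.

Definition dom0 (gamma1 gamma2 : C) (theta : R) (x : C) : Prop :=
  x <> RtoC 0 /\
  Re (Cexp (Ci * RtoC theta) / x)%C > Cmod (gamma2 - gamma1)%C.

Definition H0 (beta1 beta2 gamma1 gamma2 : C) (theta : R) (x : C)
    : matrix (T := C) 2 2 :=
  M2 (RtoC 1)
     (x ^ 2 / (beta2 - beta1)
        + (gamma2 - gamma1) * x ^ 2 * phi0 beta1 beta2 gamma1 gamma2 theta x)%C
     (RtoC 0)
     (RtoC 1).

(** [e^(G x) H(x) x^Lambda e^(-B/x)] with [G = diag(gamma1, gamma2)],
    [Lambda = diag(0, -2)] and [B = diag(beta1, beta2)]. As [Lambda] is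
    integral, [x^Lambda] involves no choice of logarithm. *)
Definition Phi0 (beta1 beta2 gamma1 gamma2 : C) (theta : R) (x : C)
    : matrix (T := C) 2 2 :=
  mul2 (mul2 (mul2
    (diag2 (Cexp (gamma1 * x)%C) (Cexp (gamma2 * x)%C))
    (H0 beta1 beta2 gamma1 gamma2 theta x))
    (diag2 (RtoC 1) (/ x ^ 2)%C))
    (diag2 (Cexp (- (beta1 / x))%C) (Cexp (- (beta2 / x))%C)).

(** * Singular directions and Stokes matrices at the origin *)

Definition singular_direction0 (beta1 beta2 : C) (theta : R) : Prop :=
  exists r : R, 0 < r /\
    laplace_den beta1 beta2 (RtoC r * Cexp (Ci * RtoC theta))%C = RtoC 0.

(** The common domain is required to be nonempty so that at most one [St]
    satisfies this. *)
Definition is_Stokes0 (beta1 beta2 gamma1 gamma2 : C) (theta : R)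
    (St : matrix (T := C) 2 2) : Prop :=
  exists eps0 : R, 0 < eps0 /\
    forall eps : R, 0 < eps < eps0 ->
      (exists x : C, dom0 gamma1 gamma2 (theta + eps) x /\
                     dom0 gamma1 gamma2 (theta - eps) x) /\
      (forall x : C,
         dom0 gamma1 gamma2 (theta + eps) x ->
         dom0 gamma1 gamma2 (theta - eps) x ->
         exists N : matrix (T := C) 2 2,
           is_inv2 (Phi0 beta1 beta2 gamma1 gamma2 (theta + eps) x) N /\
           mul2 N (Phi0 beta1 beta2 gamma1 gamma2 (theta - eps) x) = St).

Definition S0 (beta1 beta2 gamma1 gamma2 : C) : C :=
  CSeries (fun n =>
    (- RtoC 1) ^ (n + 1) * (gamma2 - gamma1) ^ n * (beta2 - beta1) ^ n
      / RtoC (INR (fact n) * INR (fact (n + 1))))%C.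

(* Main.v *)
(* (gamma2-gamma1) times the Laplace transform of u is e^((gamma2-gamma1) x) - 1 along every ray; after
   differentiation of phi_theta under the integral sign this is exactly the differential equation for
   the (1,2) entry. For the Stokes matrix, replace u by its Taylor polynomials: dividing zeta^k by
   zeta - b, b = beta1 - beta2, leaves direction-independent moments plus b^k times the integral of
   e^(-zeta/x)/(zeta - b), whose jump across the ray through b is 2 pi i e^(-b/x). That residue is
   computed on the triangle with vertices 0, R e^(i(theta-eps)), R e^(i(theta+eps)). *)

Require Import Defs.
From Stdlib Require Import Reals ZArith Lra Lia FunctionalExtensionality.
From Coquelicot Require Import Coquelicot.

Open Scope R_scope.

(** Put g = gamma2 - gamma1. The condition Re(e^(i theta)/x) > |g| carries every interchange of
    limit and integral: both u and the error of its n-th Taylor polynomial are bounded by a constant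
    times e^(|g| |zeta|), and for the error this constant is of order 1/(n+1). After multiplication
    by the kernel the error has an integral of order 1/(n+1), so integrals of u are limits of finite
    sums of moments.

    The obstacle is the residue. It is reached by deforming the exponent rather than the contour,
    until only 1/(zeta - b) is left. Because the triangle is symmetric about the ray through b, the
    logarithms cancel, only arctangents remain, and the angles seen from b add up to one full turn.

    The k-th moment jumps by b^k times the jump of the zeroth one; these powers reassemble u(b), and
    S = -u(b). The factor e^(-b/x) of the jump carries e^(-beta2/x) to e^(-beta1/x), which is why
    the Stokes matrix does not depend on x. Since g may vanish, it is kept as a factor and never
    divided by. *)

Lemma C_ext (z w : C) : Re z = Re w -> Im z = Im w -> z = w.
Proof. destruct z, w; simpl; intros; subst; reflexivity. Qed.

Lemma Cexp_plus (z w : C) : Cexp (z + w)%C = (Cexp z * Cexp w)%C.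
Proof.
  apply C_ext; unfold Cexp; simpl; rewrite exp_plus;
    [rewrite cos_plus | rewrite sin_plus]; unfold Re, Im; ring.
Qed.

Lemma Cexp_0 : Cexp (RtoC 0) = RtoC 1.
Proof. apply C_ext; unfold Cexp; simpl; rewrite exp_0, ?cos_0, ?sin_0; ring. Qed.

Lemma Cexp_neg_r (z : C) : (Cexp z * Cexp (- z) = RtoC 1)%C.
Proof. rewrite <- Cexp_plus, Cplus_opp_r. apply Cexp_0. Qed.

Lemma Cexp_nz (z : C) : Cexp z <> RtoC 0.
Proof.
  intros E. pose proof (Cexp_neg_r z) as H. rewrite E, Cmult_0_l in H.
  apply C1_nz. symmetry; exact H.
Qed.

Lemma Cexp_neg (z : C) : Cexp (- z)%C = (/ Cexp z)%C.
Proof.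
  rewrite <- (Cmult_1_l (Cexp (- z)%C)), <- (Cinv_l (Cexp z) (Cexp_nz z)).
  rewrite <- Cmult_assoc, Cexp_neg_r. ring.
Qed.

Lemma Cmod_Cexp (z : C) : Cmod (Cexp z) = exp (Re z).
Proof.
  unfold Cmod, Cexp; simpl.
  replace (_ + _) with (exp (Re z) * exp (Re z) * ((sin (Im z))² + (cos (Im z))²))
    by (unfold Rsqr; ring).
  rewrite sin2_cos2, Rmult_1_r. apply sqrt_square. left; apply exp_pos.
Qed.

Lemma exp_le (x y : R) : x <= y -> exp x <= exp y.
Proof. intros [H | ->]; [left; apply exp_increasing; exact H | right; reflexivity]. Qed.

(** * Componentwise calculus of functions from R to C *)

(** Working by coordinates reduces calculus along a real parameter to real derivatives, for which
    the product and chain rules and the fundamental theorem of calculus are at hand. *)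
Definition cder (f : R -> C) (t : R) (l : C) : Prop :=
  is_derive (fun s => Re (f s)) t (Re l) /\ is_derive (fun s => Im (f s)) t (Im l).

Definition ccont (f : R -> C) (t : R) : Prop :=
  continuous (fun s => Re (f s)) t /\ continuous (fun s => Im (f s)) t.

Lemma cder_ccont (f : R -> C) (t : R) (l : C) : cder f t l -> ccont f t.
Proof.
  intros [H1 H2]; split; rapply @ex_derive_continuous; eexists; eassumption.
Qed.

Lemma cder_eq (f : R -> C) (t : R) (l l' : C) : cder f t l -> l = l' -> cder f t l'.
Proof. intros H <-; exact H. Qed.

Lemma cder_ext (f g : R -> C) (t : R) (l : C) :
  (forall s, f s = g s) -> cder f t l -> cder g t l.
Proof.
  intros E [H1 H2]; split;
    [eapply is_derive_ext; [|exact H1] | eapply is_derive_ext; [|exact H2]];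
    intros s; simpl; rewrite E; reflexivity.
Qed.

Lemma cder_const (c : C) (t : R) : cder (fun _ => c) t (RtoC 0).
Proof. split; simpl; rapply @is_derive_const. Qed.

Lemma cder_RtoC (f : R -> R) (t l : R) :
  is_derive f t l -> cder (fun s => RtoC (f s)) t (RtoC l).
Proof. intros H; split; simpl; [exact H | rapply @is_derive_const]. Qed.

Lemma cder_id (t : R) : cder RtoC t (RtoC 1).
Proof. apply (cder_RtoC (fun s => s)). rapply @is_derive_id. Qed.

Lemma cder_plus (f g : R -> C) (t : R) (lf lg : C) :
  cder f t lf -> cder g t lg -> cder (fun s => f s + g s)%C t (lf + lg)%C.
Proof.
  intros [f1 f2] [g1 g2]; split; simpl.
  - apply (is_derive_plus _ _ _ _ _ f1 g1).
  - apply (is_derive_plus _ _ _ _ _ f2 g2).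
Qed.

Lemma is_derive_Rmult (f g : R -> R) (t a b : R) :
  is_derive f t a -> is_derive g t b ->
  is_derive (fun s => f s * g s) t (a * g t + f t * b).
Proof. intros Hf Hg. exact (is_derive_mult f g t a b Hf Hg Rmult_comm). Qed.

Lemma cder_mult (f g : R -> C) (t : R) (lf lg : C) :
  cder f t lf -> cder g t lg ->
  cder (fun s => f s * g s)%C t (lf * g t + f t * lg)%C.
Proof.
  intros [f1 f2] [g1 g2]; split; simpl.
  - evar_last.
    + apply @is_derive_minus; apply is_derive_Rmult; eassumption.
    + unfold Re, Im, minus, plus, opp; simpl; ring.
  - evar_last.
    + apply @is_derive_plus; apply is_derive_Rmult; eassumption.
    + unfold Re, Im, plus; simpl; ring.
Qed.

Lemma cder_scal (c : C) (f : R -> C) (t : R) (l : C) :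
  cder f t l -> cder (fun s => c * f s)%C t (c * l)%C.
Proof.
  intros H. eapply cder_eq; [apply cder_mult; [apply cder_const | exact H] | simpl; ring].
Qed.

Lemma cder_Cexp (f : R -> C) (t : R) (l : C) :
  cder f t l -> cder (fun s => Cexp (f s)) t (l * Cexp (f t))%C.
Proof.
  intros [f1 f2]; unfold Cexp; split; simpl.
  - evar_last.
    + apply is_derive_Rmult.
      * apply (is_derive_comp exp); [apply is_derive_exp | exact f1].
      * apply (is_derive_comp cos); [apply is_derive_cos | exact f2].
    + unfold plus, mult, scal; simpl; unfold mult; simpl; unfold Re, Im; ring.
  - evar_last.
    + apply is_derive_Rmult.
      * apply (is_derive_comp exp); [apply is_derive_exp | exact f1].
      * apply (is_derive_comp sin); [apply is_derive_sin | exact f2].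
    + unfold plus, mult, scal; simpl; unfold mult; simpl; unfold Re, Im; ring.
Qed.

Lemma cder_pow (f : R -> C) (t : R) (l : C) (n : nat) :
  cder f t l -> cder (fun s => f s ^ S n)%C t (RtoC (INR (S n)) * f t ^ n * l)%C.
Proof.
  intros H. induction n as [|n IH].
  - eapply cder_eq; [eapply (cder_ext f); [intros; simpl; ring | exact H]|].
    simpl; ring.
  - eapply cder_eq; [apply (cder_mult f (fun s => f s ^ S n)%C); eassumption|].
    rewrite (S_INR (S n)), RtoC_plus. simpl Cpow. ring.
Qed.

Lemma ccont_ext (f g : R -> C) (t : R) :
  (forall s, f s = g s) -> ccont f t -> ccont g t.
Proof.
  intros E [H1 H2]; split;
    [eapply continuous_ext; [|exact H1] | eapply continuous_ext; [|exact H2]];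
    intros s; simpl; rewrite E; reflexivity.
Qed.

Lemma ccont_mult (f g : R -> C) (t : R) :
  ccont f t -> ccont g t -> ccont (fun s => f s * g s)%C t.
Proof.
  intros [f1 f2] [g1 g2]; split; simpl.
  - rapply @continuous_minus; rapply @continuous_mult; assumption.
  - rapply @continuous_plus; rapply @continuous_mult; assumption.
Qed.

Lemma ccont_plus (f g : R -> C) (t : R) :
  ccont f t -> ccont g t -> ccont (fun s => f s + g s)%C t.
Proof.
  intros [f1 f2] [g1 g2]; split; simpl; rapply @continuous_plus; assumption.
Qed.

Lemma ccont_const (c : C) (t : R) : ccont (fun _ => c) t.
Proof. eapply cder_ccont, cder_const. Qed.

Lemma ccont_pow (f : R -> C) (t : R) (n : nat) :
  ccont f t -> ccont (fun s => f s ^ n)%C t.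
Proof.
  intros H. induction n as [|n IH]; [apply (ccont_const (RtoC 1))|].
  exact (ccont_mult _ _ t H IH).
Qed.

Lemma Cmod_sq_nz (z : C) : z <> RtoC 0 -> Re z ^ 2 + Im z ^ 2 <> 0.
Proof.
  intros H E. apply H. apply Cmod_eq_0. unfold Cmod.
  change (fst z) with (Re z); change (snd z) with (Im z). rewrite E; apply sqrt_0.
Qed.

Lemma ccont_inv (f : R -> C) (t : R) :
  ccont f t -> f t <> RtoC 0 -> ccont (fun s => / f s)%C t.
Proof.
  intros [f1 f2] H.
  assert (D : continuous (fun s => / (Re (f s) ^ 2 + Im (f s) ^ 2)) t).
  { apply (continuous_comp (fun s => Re (f s) ^ 2 + Im (f s) ^ 2) Rinv).
    - rapply @continuous_plus; simpl.
      + rapply @continuous_mult; [exact f1 | rapply @continuous_mult; [exact f1 | rapply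
          @continuous_const]].
      + rapply @continuous_mult; [exact f2 | rapply @continuous_mult; [exact f2 | rapply
          @continuous_const]].
    - apply continuous_Rinv. apply Cmod_sq_nz; exact H. }
  split; simpl.
  - unfold Rdiv; rapply @continuous_mult; [exact f1 | exact D].
  - unfold Rdiv; rapply @continuous_mult; [rapply @continuous_opp; exact f2 | exact D].
Qed.

(** * Integrals of complex-valued functions over real intervals *)

Definition cint (f : R -> C) (a b : R) (I : C) : Prop :=
  is_RInt (V := C_R_NormedModule) f a b I.

Lemma cint_comp (f : R -> C) (a b : R) (I : C) :
  cint f a b I <->
  is_RInt (fun t => Re (f t)) a b (Re I) /\ is_RInt (fun t => Im (f t)) a b (Im I).
Proof.
  split.
  - intros H; split.
    + apply (is_RInt_fct_extend_fst (U := R_NormedModule) (V := R_NormedModule) f a b I H).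
    + apply (is_RInt_fct_extend_snd (U := R_NormedModule) (V := R_NormedModule) f a b I H).
  - intros [H1 H2]. destruct I as [x y].
    apply (is_RInt_fct_extend_pair (U := R_NormedModule) (V := R_NormedModule)); assumption.
Qed.

Lemma cint_plus (f g : R -> C) (a b : R) (If Ig : C) :
  cint f a b If -> cint g a b Ig -> cint (fun t => f t + g t)%C a b (If + Ig)%C.
Proof. intros Hf Hg. apply (is_RInt_plus (V := C_R_NormedModule) _ _ _ _ _ _ Hf Hg). Qed.

Lemma cint_scal (c : C) (f : R -> C) (a b : R) (I : C) :
  cint f a b I -> cint (fun t => c * f t)%C a b (c * I)%C.
Proof.
  intros [H1 H2]%cint_comp. apply cint_comp; split; simpl.
  - rapply @is_RInt_minus; rapply @is_RInt_scal; assumption.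
  - rapply @is_RInt_plus; rapply @is_RInt_scal; assumption.
Qed.

Lemma cint_ext (f g : R -> C) (a b : R) (I : C) :
  a <= b -> (forall t, a <= t <= b -> f t = g t) -> cint f a b I -> cint g a b I.
Proof.
  intros ab E H. apply (is_RInt_ext (V := C_R_NormedModule) f g); [|exact H].
  intros t. rewrite Rmin_left, Rmax_right by exact ab. intros ?; apply E; lra.
Qed.

Lemma cint_unique (f : R -> C) (a b : R) (I J : C) :
  cint f a b I -> cint f a b J -> I = J.
Proof.
  intros HI HJ.
  rewrite <- (is_RInt_unique (V := C_R_CompleteNormedModule) f a b I HI).
  apply (is_RInt_unique (V := C_R_CompleteNormedModule) f a b J HJ).
Qed.

Lemma cint_cont (f : R -> C) (a b : R) :
  a <= b -> (forall t, a <= t <= b -> ccont f t) -> exists I, cint f a b I.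
Proof.
  intros ab H.
  destruct (ex_RInt_continuous (V := R_CompleteNormedModule) (fun t => Re (f t)) a b) as [x Hx].
  { rewrite Rmin_left, Rmax_right by exact ab. intros t Ht; apply H, Ht. }
  destruct (ex_RInt_continuous (V := R_CompleteNormedModule) (fun t => Im (f t)) a b) as [y Hy].
  { rewrite Rmin_left, Rmax_right by exact ab. intros t Ht; apply H, Ht. }
  exists (x, y). apply cint_comp; split; assumption.
Qed.

Lemma cint_ftc (F f : R -> C) (a b : R) :
  a <= b -> (forall t, a <= t <= b -> cder F t (f t)) ->
  (forall t, a <= t <= b -> ccont f t) -> cint f a b (F b - F a)%C.
Proof.
  intros ab D K. apply cint_comp; split.
  - apply (is_RInt_derive (V := R_CompleteNormedModule) (fun t => Re (F t)) (fun t => Re (f t)));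
    rewrite Rmin_left, Rmax_right by exact ab; intros t Ht; [apply D, Ht | apply K, Ht].
  - apply (is_RInt_derive (V := R_CompleteNormedModule) (fun t => Im (F t)) (fun t => Im (f t)));
    rewrite Rmin_left, Rmax_right by exact ab; intros t Ht; [apply D, Ht | apply K, Ht].
Qed.

Lemma cint_norm_le (f : R -> C) (g : R -> R) (a b : R) (I : C) (J : R) :
  a <= b -> (forall t, a <= t <= b -> Cmod (f t) <= g t) ->
  cint f a b I -> is_RInt g a b J -> Cmod I <= J.
Proof.
  intros ab H HI HJ. rewrite Cmod_norm.
  eapply (norm_RInt_le (V := C_R_NormedModule) f g a b); try eassumption.
  intros t Ht. rewrite <- Cmod_norm. apply H, Ht.
Qed.

Lemma cint_Chasles (f : R -> C) (a b c : R) (I J : C) :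
  cint f a b I -> cint f b c J -> cint f a c (I + J)%C.
Proof. apply (is_RInt_Chasles (V := C_R_NormedModule)). Qed.

(** * Taylor expansion of the exponential *)

Definition exp_sum (z : C) (n : nat) : C :=
  sum_n (fun k => z ^ k / RtoC (INR (fact k)))%C n.

Lemma exp_sum_S (z : C) (n : nat) :
  exp_sum z (S n) = (exp_sum z n + z ^ S n / RtoC (INR (fact (S n))))%C.
Proof. unfold exp_sum. rewrite sum_Sn. reflexivity. Qed.

Lemma exp_sum_0 (z : C) : exp_sum z 0 = RtoC 1.
Proof. unfold exp_sum. rewrite sum_O. simpl. field. Qed.

Lemma INR_fact_C (n : nat) : RtoC (INR (fact n)) <> RtoC 0.
Proof. intros E. apply RtoC_inj in E. exact (INR_fact_neq_0 n E). Qed.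

Lemma INR_S_C (n : nat) : RtoC (INR (S n)) <> RtoC 0.
Proof. intros E. apply RtoC_inj in E. revert E. apply not_0_INR. lia. Qed.

Lemma fact_S_C (n : nat) :
  RtoC (INR (fact (S n))) = (RtoC (INR (S n)) * RtoC (INR (fact n)))%C.
Proof. rewrite <- RtoC_mult, <- mult_INR. reflexivity. Qed.

Lemma cder_exp_sum (z : C) (n : nat) (t : R) :
  cder (fun s => exp_sum (RtoC s * z) (S n))%C t (z * exp_sum (RtoC t * z) n)%C.
Proof.
  assert (L : cder (fun s => RtoC s * z)%C t z).
  { eapply cder_eq; [apply cder_mult; [apply cder_id | apply cder_const] | simpl; ring]. }
  induction n as [|n IH].
  - eapply (cder_ext (fun s => RtoC 1 + RtoC s * z)%C).
    + intros s. rewrite exp_sum_S. unfold exp_sum. rewrite sum_O. simpl. field.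
    + eapply cder_eq; [apply cder_plus; [apply cder_const | exact L]|].
      unfold exp_sum; rewrite sum_O. simpl. field.
  - eapply (cder_ext (fun s => exp_sum (RtoC s * z) (S n)
       + / RtoC (INR (fact (S (S n)))) * (RtoC s * z) ^ S (S n))%C).
    + intros s. rewrite (exp_sum_S _ (S n)). unfold Cdiv. ring.
    + eapply cder_eq.
      * apply cder_plus; [exact IH | apply cder_scal, cder_pow, L].
      * rewrite (exp_sum_S _ n), (fact_S_C (S n)).
        field; split; [apply INR_fact_C | apply INR_S_C].
Qed.

(** The remainder of degree n+1 at z is the integral over 0 <= t <= 1 of z times the remainder of
    degree n at tz. The bound for the latter carries t^(n+1), whose integral 1/(n+2) completes the
    factorial. *)
Lemma Cexp_taylor (n : nat) (z : C) :
  Cmod (Cexp z - exp_sum z n)%C <= Cmod z ^ S n / INR (fact (S n)) * exp (Cmod z).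
Proof.
  assert (E : forall z t, cder (fun s => Cexp (RtoC s * z))%C t (z * Cexp (RtoC t * z))%C).
  { intros w t; apply cder_Cexp.
    eapply cder_eq; [apply cder_mult; [apply cder_id | apply cder_const] | simpl; ring]. }
  revert z. induction n as [|n IH]; intros z.
  - assert (H : cint (fun t => z * Cexp (RtoC t * z))%C 0 1 (Cexp z - exp_sum z 0)%C).
    { replace (Cexp z - exp_sum z 0)%C
        with (Cexp (RtoC 1 * z) - Cexp (RtoC 0 * z))%C.
      2:{ rewrite Cmult_1_l, Cmult_0_l, Cexp_0. rewrite exp_sum_0. reflexivity. }
      apply (cint_ftc (fun t => Cexp (RtoC t * z))%C); [lra | intros; apply E|].
      intros t _. eapply cder_ccont, cder_scal, E. }
    refine (cint_norm_le _ (fun _ => Cmod z * exp (Cmod z)) 0 1 _ _ _ _ H _); [lra| |].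
    + intros t Ht. rewrite Cmod_mult, Cmod_Cexp, re_scal_l.
      apply Rmult_le_compat_l; [apply Cmod_ge_0|]. apply exp_le.
      pose proof (re_le_Cmod z). pose proof (Rle_abs (Re z)). pose proof (Cmod_ge_0 z). nra.
    + evar_last; [apply @is_RInt_const|]. unfold scal; simpl; unfold mult; simpl; field.
  - set (f := fun t : R => (z * Cexp (RtoC t * z) - z * exp_sum (RtoC t * z) n)%C).
    assert (D : forall t, cder (fun s => Cexp (RtoC s * z) - exp_sum (RtoC s * z) (S n))%C t (f t)).
    { intros t. eapply (cder_ext (fun s => Cexp (RtoC s * z) + (- RtoC 1) * exp_sum (RtoC s * z) (S
        n))%C).
      - intros s; ring.
      - eapply cder_eq; [apply cder_plus; [apply E | apply cder_scal, cder_exp_sum]|].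
        unfold f; ring. }
    assert (H : cint f 0 1 (Cexp z - exp_sum z (S n))%C).
    { replace (Cexp z - exp_sum z (S n))%C
        with ((Cexp (RtoC 1 * z) - exp_sum (RtoC 1 * z) (S n))
              - (Cexp (RtoC 0 * z) - exp_sum (RtoC 0 * z) (S n)))%C.
      2:{ rewrite Cmult_1_l, Cmult_0_l, Cexp_0.
          replace (exp_sum (RtoC 0) (S n)) with (RtoC 1); [ring|].
          symmetry. clear. induction n as [|n IH]; rewrite exp_sum_S.
          - rewrite exp_sum_0. simpl. field.
          - rewrite IH. rewrite Cpow_S, Cmult_0_l. unfold Cdiv; ring. }
      apply (cint_ftc (fun t => Cexp (RtoC t * z) - exp_sum (RtoC t * z) (S n))%C); [lra | intros;
          apply D|].
      intros t _. unfold f.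
      apply (ccont_ext (fun t => z * (Cexp (RtoC t * z) + (- RtoC 1) * exp_sum (RtoC t * z) n))%C).
      { intros; ring. }
      apply ccont_mult; [eapply cder_ccont, cder_const|].
      apply ccont_plus; [eapply cder_ccont, E|].
      apply ccont_mult; [eapply cder_ccont, cder_const|].
      (* [cder_exp_sum] speaks of degree at least one; the sum of degree 0 is the constant 1. *)
      destruct n as [|n].
      + eapply (ccont_ext (fun _ => RtoC 1)); [|eapply cder_ccont, cder_const].
        intros s; rewrite exp_sum_0; reflexivity.
      + eapply cder_ccont, cder_exp_sum. }
    refine (cint_norm_le _ (fun t => Cmod z ^ S (S n) / INR (fact (S n)) * exp (Cmod z) * t ^ S n)
      0 1 _ _ _ _ H _); [lra| |].
    + intros t Ht. unfold f.
      replace (_ - _)%C with (z * (Cexp (RtoC t * z) - exp_sum (RtoC t * z) n))%C by ring.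
      rewrite Cmod_mult.
      assert (T := IH (RtoC t * z)%C).
      rewrite Cmod_mult, Cmod_R, Rabs_pos_eq in T by lra.
      pose proof (Cmod_ge_0 z).
      assert (T' : Cmod (Cexp (RtoC t * z) - exp_sum (RtoC t * z) n)%C
         <= (t * Cmod z) ^ S n / INR (fact (S n)) * exp (Cmod z)).
      { eapply Rle_trans; [apply T|].
        apply Rmult_le_compat_l; [|apply exp_le; nra].
        apply Rmult_le_pos; [apply pow_le; nra | left; apply Rinv_0_lt_compat, INR_fact_lt_0]. }
      eapply Rle_trans; [apply Rmult_le_compat_l; [apply Cmod_ge_0 | exact T']|].
      right. rewrite Rpow_mult_distr. simpl. field. change (INR (fact (S n)) <> 0). apply INR_fact_neq_0.
    + evar_last.
      * apply (is_RInt_scal (V := R_NormedModule) (fun t => t ^ S n)).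
        apply (is_RInt_derive (V := R_CompleteNormedModule) (fun t => t ^ S (S n) / INR (S (S n)))).
        -- intros t _. auto_derive; [exact I|].
           change (match n with 0%nat => 1 | S _ => INR n + 1 end) with (INR (S n)).
           pose proof (pos_INR (S n)). rewrite <- (tech_pow_Rmult t n). field. lra.
        -- intros t _. rapply @ex_derive_continuous. auto_derive. exact I.
      * unfold scal, minus, plus, opp; simpl scal; unfold mult; cbn -[fact INR pow].
        rewrite pow1, pow_i, (fact_simpl (S n)), mult_INR by lia.
        field. split; [apply INR_fact_neq_0 | apply not_0_INR; lia].
Qed.

(** * Improper integrals over the half-line *)

(** An epsilon form of the limit behind [RInt_gen]. The finite integrals are kept as a function of
    the upper end, so that norm bounds on [0, T] pass to the limit; [cimp_RInt_gen] leads back to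
    [RInt_gen]. *)
Definition cimp (f : R -> C) (l : C) : Prop :=
  exists I : R -> C,
    (forall T, 0 <= T -> cint f 0 T (I T)) /\
    (forall eps, 0 < eps -> exists A, 0 <= A /\ forall T, A <= T -> Cmod (I T - l)%C < eps).

Lemma cimp_RInt_gen (f : R -> C) (l : C) :
  cimp f l ->
  RInt_gen (V := C_R_CompleteNormedModule) f (at_point 0) (Rbar_locally p_infty) = l.
Proof.
  intros (I & HI & HL).
  apply (is_RInt_gen_unique (V := C_R_CompleteNormedModule)).
  intros P [eps HP].
  destruct (HL eps (cond_pos eps)) as (A & HA & HL').
  apply (Filter_prod _ _ _ (fun a => a = 0) (fun b => A < b)).
  - reflexivity.
  - exists A. intros x Hx; exact Hx.
  - intros a b -> Hb. exists (I b). split.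
    + apply HI. lra.
    + apply HP. apply C_NormedModule_mixin_compat1. apply HL'. lra.
Qed.

Lemma cimp_unique (f : R -> C) (l l' : C) : cimp f l -> cimp f l' -> l = l'.
Proof. intros H H'. rewrite <- (cimp_RInt_gen f l H). apply cimp_RInt_gen, H'. Qed.

Lemma cimp_ext (f g : R -> C) (l : C) :
  (forall t, 0 <= t -> f t = g t) -> cimp f l -> cimp g l.
Proof.
  intros E (I & HI & HL). exists I; split; [|exact HL].
  intros T HT. apply (cint_ext f); [exact HT | intros; apply E; lra | apply HI, HT].
Qed.

Lemma cimp_plus (f g : R -> C) (lf lg : C) :
  cimp f lf -> cimp g lg -> cimp (fun t => f t + g t)%C (lf + lg)%C.
Proof.
  intros (I & HI & HL) (J & HJ & HM). exists (fun T => I T + J T)%C; split.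
  - intros T HT; apply cint_plus; auto.
  - intros eps He. destruct (HL (eps / 2)) as (A & HA & HL'); [lra|].
    destruct (HM (eps / 2)) as (B & HB & HM'); [lra|].
    exists (Rmax A B); split; [eapply Rle_trans; [exact HA | apply Rmax_l]|].
    intros T HT. pose proof (Rmax_l A B). pose proof (Rmax_r A B).
    replace (I T + J T - (lf + lg))%C with ((I T - lf) + (J T - lg))%C by ring.
    eapply Rle_lt_trans; [apply Cmod_triangle|].
    specialize (HL' T ltac:(lra)). specialize (HM' T ltac:(lra)). lra.
Qed.

Lemma cimp_scal (c : C) (f : R -> C) (l : C) :
  cimp f l -> cimp (fun t => c * f t)%C (c * l)%C.
Proof.
  intros (I & HI & HL). exists (fun T => c * I T)%C; split.
  - intros T HT; apply cint_scal; auto.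
  - intros eps He. pose proof (Cmod_ge_0 c).
    destruct (HL (eps / (Cmod c + 1))) as (A & HA & HL').
    { apply Rdiv_lt_0_compat; lra. }
    exists A; split; [exact HA|]. intros T HT.
    replace (c * I T - c * l)%C with (c * (I T - l))%C by ring. rewrite Cmod_mult.
    specialize (HL' T HT). pose proof (Cmod_ge_0 (I T - l)%C).
    apply (Rmult_lt_compat_r (Cmod c + 1)) in HL'; [|lra].
    unfold Rdiv in HL'. rewrite Rmult_assoc, Rinv_l, Rmult_1_r in HL' by lra. nra.
Qed.

Lemma cimp_minus (f g : R -> C) (lf lg : C) :
  cimp f lf -> cimp g lg -> cimp (fun t => f t - g t)%C (lf - lg)%C.
Proof.
  intros Hf Hg.
  replace (lf - lg)%C with (lf + (- RtoC 1) * lg)%C by ring.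
  apply (cimp_ext (fun t => f t + (- RtoC 1) * g t)%C); [intros; ring|].
  apply cimp_plus; [exact Hf | apply cimp_scal, Hg].
Qed.

Lemma is_RInt_exp_neg (M c a b : R) :
  c <> 0 -> is_RInt (fun t => M * exp (- (c * t))) a b (M / c * (exp (- (c * a)) - exp (- (c * b)))).
Proof.
  intros Hc. evar_last.
  - apply (is_RInt_derive (V := R_CompleteNormedModule) (fun t => - M / c * exp (- (c * t)))).
    + intros t _. auto_derive; [exact I|]. field. exact Hc.
    + intros t _. rapply @ex_derive_continuous. auto_derive. exact I.
  - unfold minus, plus, opp; simpl. field. exact Hc.
Qed.

Lemma exp_neg_small (M c eps : R) :
  0 < c -> 0 <= M -> 0 < eps -> exists A, 0 <= A /\ forall T, A <= T -> M * exp (- (c * T)) < eps.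
Proof.
  (* By e^s >= 1 + s with s = cT, the inequality M <= c T eps is enough; the summand 1 makes the
     result strict. *)
  intros Hc HM He. exists (M / (c * eps)). split.
  { apply Rle_mult_inv_pos; [exact HM | nra]. }
  intros T HT.
  assert (H : M <= c * T * eps).
  { apply (Rmult_le_compat_r (c * eps)) in HT; [|nra].
    unfold Rdiv in HT. rewrite Rmult_assoc, Rinv_l, Rmult_1_r in HT by nra. lra. }
  rewrite exp_Ropp. pose proof (exp_pos (c * T)) as Hp.
  assert (E : 1 + c * T <= exp (c * T)) by apply exp_ineq1_le.
  apply (Rmult_lt_reg_r (exp (c * T))); [exact Hp|].
  rewrite Rmult_assoc, Rinv_l, Rmult_1_r by lra. nra.
Qed.

Lemma cimp_bound (f : R -> C) (l : C) (M c : R) :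
  0 < c -> 0 <= M -> (forall t, 0 <= t -> Cmod (f t) <= M * exp (- (c * t))) ->
  cimp f l -> Cmod l <= M / c.
Proof.
  intros Hc HM HB (I & HI & HL). apply Rle_plus_epsilon. intros eps He.
  destruct (HL eps He) as (A & HA & HL'). specialize (HL' A (Rle_refl A)).
  assert (Cmod (I A) <= M / c * (exp (- (c * 0)) - exp (- (c * A)))).
  { refine (cint_norm_le f (fun t => M * exp (- (c * t))) 0 A _ _ HA _ (HI A HA) _).
    - intros t Ht. apply HB; lra.
    - apply is_RInt_exp_neg; lra. }
  rewrite Rmult_0_r, Ropp_0, exp_0 in H. pose proof (exp_pos (- (c * A))).
  assert (0 <= M / c) by (apply Rle_mult_inv_pos; lra).
  assert (Cmod l <= Cmod (I A) + Cmod (I A - l)%C).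
  { replace l with (I A + - (I A - l))%C at 1 by ring.
    eapply Rle_trans; [apply Cmod_triangle|]. rewrite Cmod_opp. lra. }
  nra.
Qed.

(** The integral over [S, T] is at most (M/c) e^(-cS), so the finite integrals satisfy the Cauchy
    criterion at infinity, and completeness gives the limit. *)
Lemma cimp_exists (f : R -> C) (M c : R) :
  0 < c -> 0 <= M -> (forall t, 0 <= t -> ccont f t) ->
  (forall t, 0 <= t -> Cmod (f t) <= M * exp (- (c * t))) -> exists l, cimp f l.
Proof.
  intros Hc HM HC HB.
  set (I := fun T => RInt (V := C_R_CompleteNormedModule) f 0 T).
  assert (HI : forall T, 0 <= T -> cint f 0 T (I T)).
  { intros T HT. destruct (cint_cont f 0 T HT) as [J HJ]; [intros; apply HC; lra|].
    unfold I. rewrite (is_RInt_unique (V := C_R_CompleteNormedModule) f 0 T J HJ). exact HJ. }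
  assert (HD : forall S T, 0 <= S -> S <= T -> Cmod (I T - I S)%C <= M / c * exp (- (c * S))).
  { intros S T HS HST. destruct (cint_cont f S T HST) as [J HJ]; [intros; apply HC; lra|].
    assert (E : I T = (I S + J)%C).
    { eapply cint_unique; [apply HI; lra | eapply cint_Chasles; [apply HI, HS | exact HJ]]. }
    rewrite E. replace (I S + J - I S)%C with J by ring.
    assert (Cmod J <= M / c * (exp (- (c * S)) - exp (- (c * T)))).
    { refine (cint_norm_le f (fun t => M * exp (- (c * t))) S T _ _ HST _ HJ _).
      - intros t Ht. apply HB; lra.
      - apply is_RInt_exp_neg; lra. }
    pose proof (exp_pos (- (c * T))).
    assert (0 <= M / c) by (apply Rle_mult_inv_pos; lra). nra. }
  assert (HMc : 0 <= M / c) by (apply Rle_mult_inv_pos; lra).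
  destruct (proj1 (filterlim_locally_cauchy (U := C_R_CompleteNormedModule)
     (F := Rbar_locally p_infty) I)) as [l Hl].
  { intros eps. destruct (exp_neg_small (M / c) c eps Hc HMc (cond_pos eps)) as (A & HA & HS).
    exists (fun T => A < T). split; [exists A; intros x Hx; exact Hx|].
    intros u v Hu Hv. destruct (Rle_dec u v) as [Huv | Huv].
    - apply C_NormedModule_mixin_compat1.
      eapply Rle_lt_trans; [apply HD; lra | apply HS; lra].
    - apply (ball_sym (I v)). apply C_NormedModule_mixin_compat1.
      eapply Rle_lt_trans; [apply HD; lra | apply HS; lra]. }
  exists l, I. split; [exact HI|]. intros eps He.
  (* [ball] in C controls the two coordinates separately, while the modulus is at most sqrt 2 < 2
     times the larger of them; hence eps/2. *)
  assert (He2 : 0 < eps / 2) by lra.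
  destruct (proj1 (filterlim_locally I l) Hl (mkposreal _ He2)) as [A HA].
  exists (Rmax 0 (A + 1)). split; [apply Rmax_l|]. intros T HT.
  pose proof (Rmax_r 0 (A + 1)).
  assert (B := HA T ltac:(lra)). destruct B as [B1 B2].
  change (Rabs (Re (I T) - Re l) < eps / 2) in B1.
  change (Rabs (Im (I T) - Im l) < eps / 2) in B2.
  eapply Rle_lt_trans; [apply Cmod_2Rmax|].
  change (sqrt 2 * Rmax (Rabs (Re (I T) - Re l)) (Rabs (Im (I T) - Im l)) < eps).
  assert (Rmax (Rabs (Re (I T) - Re l)) (Rabs (Im (I T) - Im l)) < eps / 2)
    by (apply Rmax_lub_lt; assumption).
  assert (0 <= Rmax (Rabs (Re (I T) - Re l)) (Rabs (Im (I T) - Im l)))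
    by (eapply Rle_trans; [apply Rabs_pos | apply Rmax_l]).
  assert (sqrt 2 < 2).
  { rewrite <- (sqrt_square 2) at 2 by lra. apply sqrt_lt_1; lra. }
  pose proof (sqrt_pos 2). nra.
Qed.

Lemma cimp_ftc (F f : R -> C) (M c : R) :
  0 < c -> 0 <= M ->
  (forall t, 0 <= t -> cder F t (f t)) -> (forall t, 0 <= t -> ccont f t) ->
  (forall t, 0 <= t -> Cmod (F t) <= M * exp (- (c * t))) ->
  cimp f (- F 0)%C.
Proof.
  intros Hc HM HD HC HB. exists (fun T => F T - F 0)%C. split.
  - intros T HT. apply cint_ftc; [exact HT | intros; apply HD; lra | intros; apply HC; lra].
  - intros eps He. destruct (exp_neg_small M c eps Hc HM He) as (A & HA & HS).
    exists A; split; [exact HA|]. intros T HT.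
    replace (F T - F 0 - - F 0)%C with (F T) by ring.
    eapply Rle_lt_trans; [apply HB; lra | apply HS, HT].
Qed.

(** * Powers against exponential decay, and the moments of the exponential *)

Lemma exp_INR_mult (n : nat) (x : R) : exp (INR n * x) = exp x ^ n.
Proof.
  induction n as [|n IH]; [simpl; rewrite Rmult_0_l; apply exp_0|].
  rewrite S_INR, Rmult_plus_distr_r, exp_plus, IH, Rmult_1_l. simpl; ring.
Qed.

(** Raise s <= e^s at s = x/(n+1) to the n-th power. Dividing by n+1 instead of n covers n = 0, and
    n x/(n+1) <= x. *)
Lemma pow_le_exp (n : nat) (x : R) : 0 <= x -> x ^ n <= INR (S n) ^ n * exp x.
Proof.
  intros Hx. assert (Hn : 0 < INR (S n)) by (apply lt_0_INR; lia).
  assert (H : (x / INR (S n)) ^ n <= exp (x / INR (S n)) ^ n).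
  { assert (0 <= x / INR (S n)) by (apply Rle_mult_inv_pos; assumption).
    pose proof (exp_ineq1_le (x / INR (S n))). apply pow_incr; lra. }
  rewrite <- exp_INR_mult in H.
  assert (E : exp (INR n * (x / INR (S n))) <= exp x).
  { apply exp_le. replace x with (INR (S n) * (x / INR (S n))) at 2 by (field; lra).
    apply Rmult_le_compat_r; [apply Rle_mult_inv_pos; assumption | apply le_INR; lia]. }
  replace (x ^ n) with (INR (S n) ^ n * (x / INR (S n)) ^ n).
  2:{ rewrite <- Rpow_mult_distr. f_equal. field. lra. }
  apply Rmult_le_compat_l; [apply pow_le; lra | lra].
Qed.

(** Half of the decay absorbs the power through [pow_le_exp]; the other half is kept. *)
Lemma pow_exp_decay (n : nat) (a : R) :
  0 < a -> exists M, 0 <= M /\ forall t, 0 <= t -> t ^ n * exp (- (a * t)) <= M * exp (- (a / 2 * t)).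
Proof.
  intros Ha. exists (INR (S n) ^ n / (a / 2) ^ n).
  assert (Hp : 0 < (a / 2) ^ n) by (apply pow_lt; lra). split.
  - apply Rle_mult_inv_pos; [apply pow_le, pos_INR | exact Hp].
  - intros t Ht. assert (H := pow_le_exp n (a / 2 * t) ltac:(nra)).
    rewrite Rpow_mult_distr in H.
    replace (- (a * t)) with (- (a / 2 * t) + - (a / 2 * t)) by field.
    rewrite exp_plus, <- Rmult_assoc. apply Rmult_le_compat_r; [left; apply exp_pos|].
    rewrite exp_Ropp. pose proof (exp_pos (a / 2 * t)).
    apply (Rmult_le_reg_r (exp (a / 2 * t) * (a / 2) ^ n)); [nra|].
    field_simplify; [|lra|lra]. lra.
Qed.

Lemma Cmod_exp_ray (om : C) (t : R) : Cmod (Cexp (- (RtoC t * om))%C) = exp (- (Re om * t)).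
Proof. rewrite Cmod_Cexp, re_opp, re_scal_l. f_equal; ring. Qed.

Lemma cder_exp_ray (om : C) (t : R) :
  cder (fun s => Cexp (- (RtoC s * om)))%C t (- om * Cexp (- (RtoC t * om)))%C.
Proof.
  apply cder_Cexp. eapply (cder_ext (fun s => (- om) * RtoC s)%C); [intros; ring|].
  eapply cder_eq; [apply cder_scal, cder_id | ring].
Qed.

(** Integration by parts: t^(n+1) e^(-om t) vanishes at 0 and at infinity, so its derivative has
    integral 0, and this expresses the moment of order n+1 by that of order n. *)
Lemma moment (om : C) (n : nat) :
  0 < Re om ->
  cimp (fun t => RtoC t ^ n * Cexp (- (RtoC t * om)))%C (RtoC (INR (fact n)) / om ^ S n)%C.
Proof.
  intros Ha. assert (Hom : om <> RtoC 0) by (intros E; rewrite E in Ha; simpl in Ha; lra).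
  induction n as [|n IH].
  - eapply (cimp_ext (fun t => (- / om) * (- om * Cexp (- (RtoC t * om))))%C).
    { intros t _. simpl. field. exact Hom. }
    replace (RtoC (INR (fact 0)) / om ^ 1)%C with ((- / om) * - (Cexp (- (RtoC 0 * om))))%C.
    2:{ rewrite Cmult_0_l. replace (- RtoC 0)%C with (RtoC 0) by ring. rewrite Cexp_0. simpl.
        field. exact Hom. }
    apply cimp_scal.
    apply (cimp_ftc (fun t => Cexp (- (RtoC t * om)))%C _ 1 (Re om)); [exact Ha | lra | | |].
    + intros t _; apply cder_exp_ray.
    + intros t _; eapply cder_ccont, cder_scal, cder_exp_ray.
    + intros t _. rewrite Cmod_exp_ray. lra.
  - set (F := fun t => (RtoC t ^ S n * Cexp (- (RtoC t * om)))%C).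
    set (f := fun t => (RtoC (INR (S n)) * (RtoC t ^ n * Cexp (- (RtoC t * om))) - om * (RtoC t ^ S
        n * Cexp (- (RtoC t * om))))%C).
    assert (HD : forall t, cder F t (f t)).
    { intros t. eapply cder_eq; [apply cder_mult; [apply cder_pow, cder_id | apply cder_exp_ray]|].
      unfold f; simpl; ring. }
    assert (HP : forall t m, ccont (fun t => RtoC t ^ m * Cexp (- (RtoC t * om)))%C t).
    { intros t m. apply ccont_mult; [apply ccont_pow; exact (cder_ccont _ _ _ (cder_id t))|].
      exact (cder_ccont _ _ _ (cder_exp_ray om t)). }
    assert (H : cimp f (RtoC 0)).
    { destruct (pow_exp_decay (S n) (Re om) Ha) as (M & HM & HB).
      replace (RtoC 0) with (- F 0)%C by (unfold F; simpl; ring).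
      apply (cimp_ftc F f M (Re om / 2)); [lra | exact HM | intros; apply HD | |].
      - intros t _. unfold f.
        eapply (ccont_ext (fun t => RtoC (INR (S n)) * (RtoC t ^ n * Cexp (- (RtoC t * om))) + (-
            om) * (RtoC t ^ S n * Cexp (- (RtoC t * om))))%C); [intros; ring|].
        apply ccont_plus; (apply ccont_mult; [apply ccont_const | apply HP]).
      - intros t Ht. unfold F. rewrite Cmod_mult, Cmod_exp_ray, Cmod_pow, Cmod_R, Rabs_pos_eq by
          exact Ht.
        apply HB, Ht. }
    eapply (cimp_ext (fun t => (/ om) * (RtoC (INR (S n)) * (RtoC t ^ n * Cexp (- (RtoC t * om))) -
        f t))%C).
    { intros t _. unfold f.
      match goal with |- (_ * (?A - (?A - _ * ?B)))%C = _ =>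
        replace (A - (A - om * B))%C with (om * B)%C by ring end.
      rewrite Cmult_assoc, Cinv_l, Cmult_1_l by exact Hom. reflexivity. }
    replace (RtoC (INR (fact (S n))) / om ^ S (S n))%C
      with ((/ om) * (RtoC (INR (S n)) * (RtoC (INR (fact n)) / om ^ S n) - RtoC 0))%C.
    2:{ rewrite fact_S_C, (Cpow_S _ (S n)). field. split; [apply Cpow_nz, Hom | exact Hom]. }
    apply cimp_scal, cimp_minus; [apply cimp_scal, IH | exact H].
Qed.

(** * Limits of complex sequences and tails of complex series *)

Definition clim (s : nat -> C) (l : C) : Prop :=
  forall eps, 0 < eps -> exists N, forall n, (N <= n)%nat -> Cmod (s n - l)%C < eps.

Lemma clim_unique (s : nat -> C) (l l' : C) : clim s l -> clim s l' -> l = l'.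
Proof.
  intros H H'. destruct (Ceq_dec l l') as [E | E]; [exact E | exfalso].
  assert (D : 0 < Cmod (l - l')%C) by (apply Cmod_gt_0, Cminus_eq_contra, E).
  destruct (H (Cmod (l - l')%C / 2)) as [N HN]; [lra|].
  destruct (H' (Cmod (l - l')%C / 2)) as [N' HN']; [lra|].
  specialize (HN (N + N')%nat ltac:(lia)). specialize (HN' (N + N')%nat ltac:(lia)).
  assert (Cmod (l - l')%C <= Cmod (s (N + N')%nat - l')%C + Cmod (s (N + N')%nat - l)%C).
  { replace (l - l')%C with ((s (N + N')%nat - l') + - (s (N + N')%nat - l))%C by ring.
    eapply Rle_trans; [apply Cmod_triangle|]. rewrite Cmod_opp. lra. }
  lra.
Qed.

Lemma clim_ext (s s' : nat -> C) (l : C) :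
  (forall n, s n = s' n) -> clim s l -> clim s' l.
Proof.
  intros E H eps He. destruct (H eps He) as [N HN]. exists N. intros n Hn.
  rewrite <- E. apply HN, Hn.
Qed.

Lemma clim_squeeze (s : nat -> C) (l : C) (r : nat -> R) :
  (forall n, Cmod (s n - l)%C <= r n) -> is_lim_seq r 0 -> clim s l.
Proof.
  intros H Hr eps He. apply is_lim_seq_spec in Hr.
  destruct (Hr (mkposreal eps He)) as [N HN]. exists N. intros n Hn.
  specialize (HN n Hn). simpl in HN. rewrite Rminus_0_r in HN.
  pose proof (Rle_abs (r n)). specialize (H n). lra.
Qed.

Lemma clim_minus (s s' : nat -> C) (l l' : C) :
  clim s l -> clim s' l' -> clim (fun n => s n - s' n)%C (l - l')%C.
Proof.
  intros H H' eps He.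
  destruct (H (eps / 2)) as [N HN]; [lra|]. destruct (H' (eps / 2)) as [N' HN']; [lra|].
  exists (N + N')%nat. intros n Hn.
  specialize (HN n ltac:(lia)). specialize (HN' n ltac:(lia)).
  replace (s n - s' n - (l - l'))%C with ((s n - l) + - (s' n - l'))%C by ring.
  eapply Rle_lt_trans; [apply Cmod_triangle|]. rewrite Cmod_opp. lra.
Qed.

Lemma clim_scal (c : C) (s : nat -> C) (l : C) :
  clim s l -> clim (fun n => c * s n)%C (c * l)%C.
Proof.
  intros H eps He. pose proof (Cmod_ge_0 c).
  destruct (H (eps / (Cmod c + 1))) as [N HN]; [apply Rdiv_lt_0_compat; lra|].
  exists N. intros n Hn. specialize (HN n Hn).
  replace (c * s n - c * l)%C with (c * (s n - l))%C by ring. rewrite Cmod_mult.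
  pose proof (Cmod_ge_0 (s n - l)%C).
  apply (Rmult_lt_compat_r (Cmod c + 1)) in HN; [|lra].
  unfold Rdiv in HN. rewrite Rmult_assoc, Rinv_l, Rmult_1_r in HN by lra. nra.
Qed.

Lemma clim_S (s : nat -> C) (l : C) : clim s l -> clim (fun n => s (S n)) l.
Proof.
  intros H eps He. destruct (H eps He) as [N HN]. exists N. intros n Hn. apply HN; lia.
Qed.

Lemma exp_sum_lim (z : C) : clim (exp_sum z) (Cexp z).
Proof.
  apply (clim_squeeze _ _ (fun n => Cmod z ^ S n / INR (fact (S n)) * exp (Cmod z))).
  - intros n. replace (exp_sum z n - Cexp z)%C with (- (Cexp z - exp_sum z n))%C by ring.
    rewrite Cmod_opp. apply Cexp_taylor.
  - replace (Finite 0) with (Rbar_mult 0 (exp (Cmod z))) by (simpl; f_equal; ring).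
    apply is_lim_seq_scal_r. apply (is_lim_seq_incr_1 (fun n => Cmod z ^ n / INR (fact n))).
    apply is_lim_seq_Reals. apply cv_speed_pow_fact.
Qed.

(** The tail is compared with the whole sum s of the majorant. This loses nothing in [usum_error],
    where the majorant itself carries the small factor 1/(n+1). *)
Lemma Series_tail (a b : nat -> R) (s : R) (n : nat) :
  (forall k, (n < k)%nat -> Rabs (a k) <= b k) -> (forall k, 0 <= b k) -> is_series b s ->
  Rabs (Series a - sum_n a n) <= s.
Proof.
  intros H Hb Hs.
  assert (Eb : ex_series (fun k => b (S n + k)%nat)) by (apply ex_series_incr_n; eexists; exact Hs).
  assert (Ea' : ex_series (fun k => Rabs (a (S n + k)%nat))).
  { apply (ex_series_le (V := R_CompleteNormedModule) _ (fun k => b (S n + k)%nat)); [|exact Eb].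
    intros k. unfold norm; simpl; unfold abs; simpl. rewrite Rabs_Rabsolu. apply H; lia. }
  assert (Ea : ex_series a) by (apply (ex_series_incr_n a (S n)), ex_series_Rabs, Ea').
  rewrite (Series_incr_n a (S n)) by (lia || exact Ea). simpl pred. rewrite sum_n_Reals.
  replace (_ - _) with (Series (fun k => a (S n + k)%nat)) by ring.
  eapply Rle_trans; [apply Series_Rabs, Ea'|].
  eapply Rle_trans; [apply Series_le; [|exact Eb]|].
  - intros k; split; [apply Rabs_pos | apply H; lia].
  - rewrite <- (is_series_unique b s Hs), (Series_incr_n b (S n)) by (lia || (eexists; exact Hs)).
    assert (0 <= sum_f_R0 b (pred (S n))) by (apply cond_pos_sum; exact Hb). lra.
Qed.

Lemma Re_sum_n (a : nat -> C) (n : nat) : Re (sum_n a n) = sum_n (fun k => Re (a k)) n.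
Proof.
  induction n as [|n IH]; [rewrite !sum_O; reflexivity|].
  rewrite !sum_Sn, <- IH. reflexivity.
Qed.

Lemma Im_sum_n (a : nat -> C) (n : nat) : Im (sum_n a n) = sum_n (fun k => Im (a k)) n.
Proof.
  induction n as [|n IH]; [rewrite !sum_O; reflexivity|].
  rewrite !sum_Sn, <- IH. reflexivity.
Qed.

Lemma im_le_Cmod (z : C) : Rabs (Im z) <= Cmod z.
Proof. eapply Rle_trans; [apply Rmax_r | apply (Rmax_Cmod z)]. Qed.

Lemma Cmod_le_Re_Im (z : C) : Cmod z <= Rabs (Re z) + Rabs (Im z).
Proof.
  unfold Cmod. change (fst z) with (Re z); change (snd z) with (Im z).
  rewrite <- (sqrt_square (Rabs (Re z) + Rabs (Im z)))
    by (apply Rplus_le_le_0_compat; apply Rabs_pos).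
  apply sqrt_le_1_alt. rewrite <- (pow2_abs (Re z)), <- (pow2_abs (Im z)).
  pose proof (Rabs_pos (Re z)). pose proof (Rabs_pos (Im z)). nra.
Qed.

(** The factor 2 arises because [CSeries] is defined by coordinates, and the two coordinates are
    estimated separately. *)
Lemma CSeries_tail (a : nat -> C) (b : nat -> R) (s : R) (n : nat) :
  (forall k, (n < k)%nat -> Cmod (a k) <= b k) -> (forall k, 0 <= b k) -> is_series b s ->
  Cmod (CSeries a - sum_n a n)%C <= 2 * s.
Proof.
  intros H Hb Hs. eapply Rle_trans; [apply Cmod_le_Re_Im|].
  assert (H1 : Rabs (Re (CSeries a - sum_n a n)%C) <= s).
  { change (Re (CSeries a - sum_n a n)%C) with (Re (CSeries a) - Re (sum_n a n)).
    rewrite Re_sum_n. apply (Series_tail _ b); [|exact Hb | exact Hs].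
    intros k Hk. eapply Rle_trans; [apply re_le_Cmod | apply H, Hk]. }
  assert (H2 : Rabs (Im (CSeries a - sum_n a n)%C) <= s).
  { change (Im (CSeries a - sum_n a n)%C) with (Im (CSeries a) - Im (sum_n a n)).
    rewrite Im_sum_n. apply (Series_tail _ b); [|exact Hb | exact Hs].
    intros k Hk. eapply Rle_trans; [apply im_le_Cmod | apply H, Hk]. }
  lra.
Qed.

(** * The entire function u *)

Definition ucoef (g : C) (k : nat) : C :=
  (g ^ k / RtoC (INR (fact k) * INR (fact (k + 1))))%C.

(** Convertible to [laplace_u gamma1 gamma2] when g is [gamma2 - gamma1]. *)
Definition ufun (g z : C) : C := CSeries (fun k => ucoef g k * z ^ k)%C.

Definition usum (g : C) (n : nat) (z : C) : C := sum_n (fun k => ucoef g k * z ^ k)%C n.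

Lemma fact_prod_pos (k : nat) : 0 < INR (fact k) * INR (fact (k + 1)).
Proof. apply Rmult_lt_0_compat; apply INR_fact_lt_0. Qed.

Lemma fact_prod_C (k : nat) : RtoC (INR (fact k) * INR (fact (k + 1))) <> RtoC 0.
Proof. intros E. apply RtoC_inj in E. pose proof (fact_prod_pos k). lra. Qed.

Lemma Cmod_uterm (g z : C) (k : nat) :
  Cmod (ucoef g k * z ^ k)%C = (Cmod g * Cmod z) ^ k / (INR (fact k) * INR (fact (k + 1))).
Proof.
  unfold ucoef. rewrite Cmod_mult, Cmod_div by apply fact_prod_C.
  rewrite Cmod_R, Rabs_pos_eq by (left; apply fact_prod_pos).
  rewrite !Cmod_pow, Rpow_mult_distr. field. split; apply INR_fact_neq_0.
Qed.

Lemma is_series_exp (x : R) : is_series (fun k => x ^ k / INR (fact k)) (exp x).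
Proof.
  assert (H := is_exp_Reals x). apply is_pseries_R in H.
  eapply is_series_ext; [|exact H]. intros n; simpl. unfold Rdiv; ring.
Qed.

(** For k > n the factor (k+1)! in the denominator exceeds n+1, and what is left of the term is
    dominated by the exponential series. Only one factor of the factorial is spent: the aim is an
    error tending to 0 with the same exponential weight as u. *)
Lemma usum_error (g z : C) (n : nat) :
  Cmod (ufun g z - usum g n z)%C <= 2 * (/ INR (S n) * exp (Cmod g * Cmod z)).
Proof.
  set (x := Cmod g * Cmod z).
  assert (Hx : 0 <= x) by (apply Rmult_le_pos; apply Cmod_ge_0).
  assert (Hn : 0 < INR (S n)) by (apply lt_0_INR; lia).
  apply (CSeries_tail _ (fun k => / INR (S n) * (x ^ k / INR (fact k)))).
  - intros k Hk. rewrite Cmod_uterm. fold x.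
    replace (x ^ k / (INR (fact k) * INR (fact (k + 1))))
      with (/ INR (fact (k + 1)) * (x ^ k / INR (fact k)))
      by (field; split; apply INR_fact_neq_0).
    apply Rmult_le_compat_r.
    + apply Rle_mult_inv_pos; [apply pow_le, Hx | apply INR_fact_lt_0].
    + apply Rinv_le_contravar; [exact Hn|]. apply le_INR.
      rewrite Nat.add_1_r, fact_simpl. pose proof (lt_O_fact k). nia.
  - intros k. apply Rmult_le_pos; [left; apply Rinv_0_lt_compat, Hn|].
    apply Rle_mult_inv_pos; [apply pow_le, Hx | apply INR_fact_lt_0].
  - exact (is_series_scal_l (K := R_AbsRing) (/ INR (S n)) _ _ (is_series_exp x)).
Qed.

Lemma inv_INR_lim (K : R) : is_lim_seq (fun n => K * / INR (S n)) 0.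
Proof.
  replace (Finite 0) with (Rbar_mult K 0) by (simpl; f_equal; ring).
  apply is_lim_seq_scal_l.
  apply (is_lim_seq_inv (fun n => INR (S n)) p_infty); [|discriminate].
  apply (is_lim_seq_incr_1 INR). apply is_lim_seq_INR.
Qed.

Lemma usum_lim (g z : C) : clim (fun n => usum g n z) (ufun g z).
Proof.
  apply (clim_squeeze _ _ (fun n => 2 * exp (Cmod g * Cmod z) * / INR (S n))).
  - intros n. replace (usum g n z - ufun g z)%C with (- (ufun g z - usum g n z))%C by ring.
    rewrite Cmod_opp. eapply Rle_trans; [apply usum_error|]. right; ring.
  - apply inv_INR_lim.
Qed.

(** The leading term 1 plus the error for n = 0 gives 1 + 2 e^s <= 3 e^s with s = |g| |z|. *)
Lemma ufun_bound (g z : C) : Cmod (ufun g z) <= 3 * exp (Cmod g * Cmod z).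
Proof.
  assert (H := usum_error g z 0). unfold usum in H. rewrite sum_O in H.
  replace (ucoef g 0 * z ^ 0)%C with (RtoC 1) in H.
  2:{ unfold ucoef; simpl. rewrite Rmult_1_l. field. }
  replace (INR 1) with 1 in H by reflexivity. rewrite Rinv_1, Rmult_1_l in H.
  assert (Cmod (ufun g z) <= Cmod (ufun g z - RtoC 1)%C + 1).
  { replace (ufun g z) with ((ufun g z - RtoC 1) + RtoC 1)%C at 1 by ring.
    eapply Rle_trans; [apply Cmod_triangle|]. rewrite Cmod_1. lra. }
  assert (0 <= Cmod g * Cmod z) by (apply Rmult_le_pos; apply Cmod_ge_0).
  pose proof (exp_ineq1_le (Cmod g * Cmod z)). lra.
Qed.

Lemma continuous_PSeries_exp_dominated (a : nat -> R) (r x : R) :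
  0 <= r -> (forall k, Rabs (a k) <= r ^ k / INR (fact k)) -> continuous (PSeries a) x.
Proof.
  intros Hr H. apply continuity_pt_filterlim. apply PSeries_continuity.
  (* Convergence at |x| + 1 places x strictly inside the disk of convergence. *)
  apply (Rbar_lt_le_trans _ (Rabs x + 1)); [simpl; lra|].
  apply (proj1 (Lub_Rbar_correct (CV_disk a))).
  apply (ex_series_le (V := R_CompleteNormedModule) _ (fun k => (r * (Rabs x + 1)) ^ k / INR (fact k))).
  - intros k. unfold norm; simpl; unfold abs; simpl. rewrite Rabs_Rabsolu, Rabs_mult.
    pose proof (Rabs_pos x). rewrite <- RPow_abs, (Rabs_pos_eq (Rabs x + 1)) by lra.
    rewrite Rpow_mult_distr.
    replace (_ / _) with (r ^ k / INR (fact k) * (Rabs x + 1) ^ k) by (field; apply INR_fact_neq_0).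
    apply Rmult_le_compat_r; [apply pow_le; lra | apply H].
  - eexists; apply is_series_exp.
Qed.

(** On the ray z = s e the k-th power is e^k s^k, so the real and imaginary parts are real power
    series in s, dominated by an exponential series. *)
Lemma ccont_ufun (g e : C) (t : R) : ccont (fun s => ufun g (RtoC s * e)%C) t.
Proof.
  assert (E : forall s k, (ucoef g k * (RtoC s * e) ^ k = ucoef g k * e ^ k * RtoC (s ^ k))%C).
  { intros s k. rewrite Cpow_mult_l, RtoC_pow. ring. }
  assert (B : forall k, Cmod (ucoef g k * e ^ k)%C <= (Cmod g * Cmod e) ^ k / INR (fact k)).
  { intros k. rewrite Cmod_uterm. apply Rmult_le_compat_l.
    - apply pow_le, Rmult_le_pos; apply Cmod_ge_0.
    - apply Rinv_le_contravar; [apply INR_fact_lt_0|].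
      assert (1 <= INR (fact (k + 1))) by (apply (le_INR 1), lt_O_fact).
      pose proof (INR_fact_lt_0 k). nra. }
  split.
  - eapply (continuous_ext (PSeries (fun k => Re (ucoef g k * e ^ k)%C))).
    + intros s. unfold PSeries. change (Re (ufun g (s * e)%C)) with (Series (fun k => Re (ucoef g k
        * (RtoC s * e) ^ k)%C)).
      apply Series_ext. intros k. rewrite E, re_scal_r. reflexivity.
    + apply (continuous_PSeries_exp_dominated _ (Cmod g * Cmod e)).
      * apply Rmult_le_pos; apply Cmod_ge_0.
      * intros k. eapply Rle_trans; [apply re_le_Cmod | apply B].
  - eapply (continuous_ext (PSeries (fun k => Im (ucoef g k * e ^ k)%C))).
    + intros s. unfold PSeries. change (Im (ufun g (s * e)%C)) with (Series (fun k => Im (ucoef g k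
        * (RtoC s * e) ^ k)%C)).
      apply Series_ext. intros k. rewrite E, im_scal_r. reflexivity.
    + apply (continuous_PSeries_exp_dominated _ (Cmod g * Cmod e)).
      * apply Rmult_le_pos; apply Cmod_ge_0.
      * intros k. eapply Rle_trans; [apply im_le_Cmod | apply B].
Qed.

(** * Termwise Laplace transforms of u along a ray *)

Lemma cimp_usum (g : C) (p K : R -> C) (m : nat -> C) (n : nat) :
  (forall k, cimp (fun t => p t ^ k * K t)%C (m k)) ->
  cimp (fun t => usum g n (p t) * K t)%C (sum_n (fun k => ucoef g k * m k)%C n).
Proof.
  intros H. unfold usum. induction n as [|n IH].
  - rewrite sum_O. apply (cimp_ext (fun t => ucoef g 0 * (p t ^ 0 * K t))%C).
    + intros t _. rewrite sum_O. ring.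
    + apply cimp_scal, H.
  - rewrite sum_Sn. apply (cimp_ext (fun t => sum_n (fun k => ucoef g k * p t ^ k) n * K t
       + ucoef g (S n) * (p t ^ S n * K t))%C).
    + intros t _. rewrite sum_Sn. change plus with Cplus. ring.
    + change plus with Cplus. apply cimp_plus; [exact IH | apply cimp_scal, H].
Qed.

Lemma ufun_kernel_bound (g e : C) (K : R -> C) (M a t : R) :
  Cmod e = 1 -> 0 <= M -> 0 <= t -> Cmod (K t) <= M * exp (- (a * t)) ->
  Cmod (ufun g (RtoC t * e) * K t)%C <= 3 * M * exp (- ((a - Cmod g) * t)).
Proof.
  intros He HM Ht HK. rewrite Cmod_mult. assert (H := ufun_bound g (RtoC t * e)%C).
  rewrite Cmod_mult, Cmod_R, He, Rabs_pos_eq, Rmult_1_r in H by exact Ht.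
  eapply Rle_trans; [apply Rmult_le_compat; [apply Cmod_ge_0 | apply Cmod_ge_0 | exact H | exact HK]|].
  replace (- ((a - Cmod g) * t)) with (Cmod g * t + - (a * t)) by ring.
  rewrite exp_plus. right; ring.
Qed.

(** Termwise integration against any kernel that decays faster than u may grow. The Taylor error
    costs 2/(n+1) e^(|g| t), the kernel pays M e^(-a t), and the integral of the product is 2M/((a -
    |g|)(n+1)). It serves both the pure exponential kernel and the kernel with a pole. *)
Lemma cimp_ufun_lim (g e : C) (K : R -> C) (m : nat -> C) (M a : R) :
  Cmod e = 1 -> 0 <= M -> Cmod g < a ->
  (forall t, 0 <= t -> ccont K t) ->
  (forall t, 0 <= t -> Cmod (K t) <= M * exp (- (a * t))) ->
  (forall k, cimp (fun t => (RtoC t * e) ^ k * K t)%C (m k)) ->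
  exists l, cimp (fun t => ufun g (RtoC t * e) * K t)%C l /\
            clim (fun n => sum_n (fun k => ucoef g k * m k)%C n) l.
Proof.
  intros He HM Ha HC HB Hm.
  destruct (cimp_exists (fun t => ufun g (RtoC t * e) * K t)%C (3 * M) (a - Cmod g)) as [l Hl].
  - lra.
  - lra.
  - intros t Ht. apply ccont_mult; [apply ccont_ufun | apply HC, Ht].
  - intros t Ht. apply ufun_kernel_bound; auto.
  - exists l; split; [exact Hl|].
    apply (clim_squeeze _ _ (fun n => 2 * M / (a - Cmod g) * / INR (S n))); [|apply inv_INR_lim].
    intros n. assert (Hn : 0 < INR (S n)) by (apply lt_0_INR; lia).
    assert (D := cimp_minus _ _ _ _ (cimp_usum g (fun t => RtoC t * e)%C K m n Hm) Hl).
    apply (cimp_bound _ _ (2 * M * / INR (S n)) (a - Cmod g)) in D.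
    + eapply Rle_trans; [exact D|]. right. field. split; lra.
    + lra.
    + apply Rmult_le_pos; [lra | left; apply Rinv_0_lt_compat, Hn].
    + intros t Ht.
      replace (usum g n (t * e) * K t - ufun g (t * e) * K t)%C
        with (- (ufun g (t * e) - usum g n (t * e)) * K t)%C by ring.
      rewrite Cmod_mult, Cmod_opp. assert (H := usum_error g (RtoC t * e)%C n).
      rewrite Cmod_mult, Cmod_R, He, Rabs_pos_eq, Rmult_1_r in H by exact Ht.
      eapply Rle_trans; [apply Rmult_le_compat; [apply Cmod_ge_0 | apply Cmod_ge_0 | exact H |
          apply HB, Ht]|].
      replace (- ((a - Cmod g) * t)) with (Cmod g * t + - (a * t)) by ring.
      rewrite exp_plus. right; ring.
Qed.

(** Substituting zeta = t e produces e^(k+1), which cancels against (e w)^(k+1): this is why the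
    moments do not depend on the direction. In the application w = 1/x. *)
Lemma ray_moment (e w : C) (k : nat) :
  e <> RtoC 0 -> 0 < Re (e * w)%C ->
  cimp (fun t => (RtoC t * e) ^ k * (Cexp (- (RtoC t * (e * w))) * e))%C
       (RtoC (INR (fact k)) / w ^ S k)%C.
Proof.
  intros He H.
  assert (Hw : w <> RtoC 0).
  { intros E. rewrite E, Cmult_0_r in H. simpl in H. lra. }
  apply (cimp_ext (fun t => e ^ S k * (RtoC t ^ k * Cexp (- (RtoC t * (e * w)))))%C).
  { intros t _. rewrite Cpow_mult_l, Cpow_S. ring. }
  replace (RtoC (INR (fact k)) / w ^ S k)%C
    with (e ^ S k * (RtoC (INR (fact k)) / (e * w) ^ S k))%C.
  - apply cimp_scal, moment, H.
  - rewrite Cpow_mult_l. field. split; apply Cpow_nz; assumption.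
Qed.

(** The k! of the moment cancels the k! in the coefficient of u, and the factor g completes
    g^k/(k+1)! to the term of order k+1 of the exponential series; only the term of order 0 is
    missing. *)
Lemma usum_moments (g w : C) (n : nat) :
  w <> RtoC 0 ->
  (g * sum_n (fun k => ucoef g k * (RtoC (INR (fact k)) / w ^ S k)) n = exp_sum (g / w) (S n) -
      RtoC 1)%C.
Proof.
  intros Hw.
  assert (T : forall k, (g * (ucoef g k * (RtoC (INR (fact k)) / w ^ S k))
                        = (g / w) ^ S k / RtoC (INR (fact (S k))))%C).
  { intros k. unfold ucoef, Cdiv. rewrite Cpow_mult_l, Cpow_inv, RtoC_mult by exact Hw.
    rewrite Nat.add_1_r, (Cpow_S g). field.
    repeat split; try apply INR_fact_C. apply Cpow_nz, Hw. }
  induction n as [|n IH].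
  - rewrite sum_O, T, exp_sum_S, exp_sum_0. ring.
  - rewrite sum_Sn, exp_sum_S. change plus with Cplus.
    rewrite Cmult_plus_distr_l, IH, T. ring.
Qed.

(** The value is given for g l instead of l, so that g = 0 is no special case: both sides are then
    0. *)
Lemma laplace_ufun (g e w : C) :
  Cmod e = 1 -> Cmod g < Re (e * w)%C ->
  exists l, cimp (fun t => ufun g (RtoC t * e) * (Cexp (- (RtoC t * (e * w))) * e))%C l /\
            (g * l = Cexp (g / w) - RtoC 1)%C.
Proof.
  intros He Ha. pose proof (Cmod_ge_0 g).
  assert (He0 : e <> RtoC 0) by (intros E; rewrite E, Cmod_0 in He; lra).
  assert (Hw : w <> RtoC 0).
  { intros E. rewrite E, Cmult_0_r in Ha. simpl in Ha. lra. }
  destruct (cimp_ufun_lim g e (fun t => Cexp (- (RtoC t * (e * w))) * e)%C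
    (fun k => RtoC (INR (fact k)) / w ^ S k)%C 1 (Re (e * w)%C)) as (l & Hl & Hlim).
  - exact He.
  - lra.
  - exact Ha.
  - intros t _. apply ccont_mult; [exact (cder_ccont _ _ _ (cder_exp_ray _ t)) | apply ccont_const].
  - intros t _. rewrite Cmod_mult, He, Cmod_exp_ray. lra.
  - intros k. apply ray_moment; [exact He0 | lra].
  - exists l; split; [exact Hl|].
    apply (clim_unique (fun n => exp_sum (g / w) (S n) - RtoC 1)%C).
    + eapply clim_ext; [intros n; apply usum_moments, Hw | apply clim_scal, Hlim].
    + apply clim_minus; [apply (clim_S (exp_sum (g / w))), exp_sum_lim|].
      intros eps Heps. exists O. intros _ _. replace (_ - _)%C with (RtoC 0) by ring.
      rewrite Cmod_0. exact Heps.
Qed.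

(** * The residue of exp(-zeta w)/(zeta - b) *)

(** Adding the increments over N equal pieces of [0, 1] gives at most N K/N^2 = K/N. This is the
    vanishing of a derivative in the form in which norm estimates of parameter integrals deliver
    it. *)
Lemma quadratic_increments_const (Phi : R -> C) (K : R) :
  (forall l m, 0 <= l <= m -> m <= 1 -> Cmod (Phi m - Phi l)%C <= K * (m - l) ^ 2) ->
  Phi 1 = Phi 0.
Proof.
  intros H.
  assert (HK : 0 <= K).
  { assert (H1 := H 0 1 ltac:(lra) ltac:(lra)). pose proof (Cmod_ge_0 (Phi 1 - Phi 0)%C). lra. }
  assert (B : forall n, Cmod (Phi 1 - Phi 0)%C <= K * / INR (S n)).
  { intros n. set (N := INR (S n)). assert (HN : 0 < N) by (apply lt_0_INR; lia).
    assert (P : forall k, (k <= S n)%nat -> Cmod (Phi (INR k / N)%R - Phi 0)%C <= INR k * (K * (/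
        N) ^ 2)).
    { induction k as [|k IH]; intros Hk.
      - simpl INR. unfold Rdiv. rewrite !Rmult_0_l.
        replace (Phi 0 - Phi 0)%C with (RtoC 0) by ring. rewrite Cmod_0. lra.
      - specialize (IH ltac:(lia)). rewrite S_INR.
        assert (Hk' : INR k + 1 <= N) by (rewrite <- S_INR; apply le_INR; exact Hk).
        pose proof (pos_INR k).
        assert (HN' : 0 < / N) by (apply Rinv_0_lt_compat, HN).
        assert (E1 : (INR k + 1) / N <= 1).
        { apply (Rmult_le_reg_r N); [exact HN|]. unfold Rdiv. rewrite Rmult_assoc, Rinv_l by lra. lra. }
        assert (E0 : 0 <= INR k / N) by (apply Rle_mult_inv_pos; assumption).
        assert (D := H (INR k / N) ((INR k + 1) / N)).
        replace ((INR k + 1) / N - INR k / N) with (/ N) in D by (field; lra).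
        replace ((INR k + 1) / N) with (INR k / N + / N) in * by (field; lra).
        specialize (D ltac:(lra) E1).
        set (x := INR k / N) in *.
        replace (Phi (x + / N)%R - Phi 0)%C
          with ((Phi (x + / N)%R - Phi x) + (Phi x - Phi 0))%C by ring.
        eapply Rle_trans; [apply Cmod_triangle|]. lra. }
    specialize (P (S n) (Nat.le_refl _)). fold N in P.
    replace (N / N) with 1 in P by (field; lra).
    eapply Rle_trans; [exact P|]. right. field. lra. }
  assert (Z : Cmod (Phi 1 - Phi 0)%C <= 0).
  { assert (L := is_lim_seq_le _ _ (Finite (Cmod (Phi 1 - Phi 0)%C)) (Finite 0) B (is_lim_seq_const
      _) (inv_INR_lim K)).
    exact L. }
  apply Ceq_minus, Cmod_eq_0. pose proof (Cmod_ge_0 (Phi 1 - Phi 0)%C). lra.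
Qed.

(** A primitive in z of e^(-l (z - b) w). The general formula degenerates at l = 0, where the
    integrand is 1 and the primitive is z. *)
Definition exp_prim (b w : C) (l : R) (z : C) : C :=
  if Req_EM_T l 0 then z else (- Cexp (- (RtoC l * ((z - b) * w))) / (RtoC l * w))%C.

Lemma cder_line (p d : C) (t : R) : cder (fun s => p + RtoC s * d)%C t d.
Proof.
  eapply cder_eq; [apply cder_plus; [apply cder_const | apply cder_mult; [apply cder_id | apply
      cder_const]]|].
  cbv beta; ring.
Qed.

Lemma cder_exp_line (p d b w : C) (l t : R) :
  cder (fun s => Cexp (- (RtoC l * ((p + RtoC s * d - b) * w))))%C t
       (- (RtoC l * (d * w)) * Cexp (- (RtoC l * ((p + RtoC t * d - b) * w))))%C.
Proof.
  apply (cder_Cexp (fun s => - (RtoC l * ((p + RtoC s * d - b) * w)))%C).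
  eapply (cder_ext (fun s => - (RtoC l * ((p - b) * w)) + RtoC s * (- (RtoC l * (d * w))))%C).
  - intros s; ring.
  - apply cder_line.
Qed.

Lemma cint_exp_line (p d b w : C) (l A B : R) :
  w <> RtoC 0 -> A <= B ->
  cint (fun t => Cexp (- (RtoC l * ((p + RtoC t * d - b) * w))) * d)%C A B
       (exp_prim b w l (p + RtoC B * d) - exp_prim b w l (p + RtoC A * d))%C.
Proof.
  intros Hw AB.
  apply (cint_ftc (fun t => exp_prim b w l (p + RtoC t * d)%C)); [exact AB | |].
  - intros t _. unfold exp_prim. destruct (Req_EM_T l 0) as [-> | Hl].
    + eapply cder_eq; [apply cder_line|].
      rewrite Cmult_0_l. replace (- RtoC 0)%C with (RtoC 0) by ring. rewrite Cexp_0. ring.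
    + assert (Hl' : RtoC l <> RtoC 0) by (intros E; apply Hl, RtoC_inj, E).
      eapply (cder_ext (fun s => - / (RtoC l * w) * Cexp (- (RtoC l * ((p + RtoC s * d - b) * w))))%C).
      { intros s. unfold Cdiv. ring. }
      eapply cder_eq; [apply cder_scal, cder_exp_line|]. field. split; assumption.
  - intros t _. apply ccont_mult; [exact (cder_ccont _ _ _ (cder_exp_line p d b w l t)) | apply
      ccont_const].
Qed.

Lemma Cexp_second_order (z : C) : Cmod (Cexp z - RtoC 1 - z)%C <= Cmod z ^ 2 * exp (Cmod z).
Proof.
  assert (H := Cexp_taylor 1 z). rewrite exp_sum_S, exp_sum_0 in H.
  replace (Cexp z - RtoC 1 - z)%C
    with (Cexp z - (RtoC 1 + z ^ 1 / RtoC (INR (fact 1))))%C by (simpl; field).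
  eapply Rle_trans; [exact H|]. pose proof (exp_pos (Cmod z)). pose proof (Cmod_ge_0 z).
  simpl fact. replace (INR 2) with 2 by reflexivity. apply Rmult_le_compat_r; [lra|]. nra.
Qed.

(* The deformation exp(-l (zeta - b) w), 0 <= l <= 1, joins the residue integrand (l = 1) to
    1/(zeta - b);
   its derivative in l no longer has a pole, so it integrates to zero over a closed contour. *)
Lemma segment_deformation (p d b w : C) (A B : R) :
  w <> RtoC 0 -> A <= B -> (forall t, A <= t <= B -> (p + RtoC t * d - b)%C <> RtoC 0) ->
  exists (I : R -> C) (K : R),
    (forall l, cint (fun t => Cexp (- (RtoC l * ((p + RtoC t * d - b) * w))) * d
                              / (p + RtoC t * d - b))%C A B (I l)) /\
    (forall l m, 0 <= l <= m -> m <= 1 ->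
       Cmod (I m - I l + RtoC (m - l) * w *
             (exp_prim b w l (p + RtoC B * d) - exp_prim b w l (p + RtoC A * d)))%C <= K * (m - l) ^ 2).
Proof.
  intros Hw AB Hnz.
  set (f := fun l t => (Cexp (- (RtoC l * ((p + RtoC t * d - b) * w))) * d / (p + RtoC t * d - b))%C).
  set (I := fun l => RInt (V := C_R_CompleteNormedModule) (f l) A B).
  assert (HI : forall l, cint (f l) A B (I l)).
  { intros l. destruct (cint_cont (f l) A B AB) as [J HJ].
    - intros t Ht. unfold f, Cdiv. apply ccont_mult; [apply ccont_mult|].
      + exact (cder_ccont _ _ _ (cder_exp_line p d b w l t)).
      + apply ccont_const.
      + apply ccont_inv; [|apply Hnz, Ht].
        eapply (ccont_ext (fun s => (p - b) + RtoC s * d)%C); [intros; ring|].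
        exact (cder_ccont _ _ _ (cder_line (p - b)%C d t)).
    - unfold I. rewrite (is_RInt_unique (V := C_R_CompleteNormedModule) (f l) A B J HJ). exact HJ. }
  (* Z bounds |zeta - b| on the segment. In K0 the exponent is doubled because e^(-l (zeta - b) w)
     and the second-order remainder each contribute e^(Z |w|). *)
  set (Z := Cmod p + Cmod b + (Rabs A + Rabs B) * Cmod d).
  set (K0 := Cmod d * (Z * Cmod w ^ 2) * exp (2 * (Z * Cmod w))).
  exists I, ((B - A) * K0). split; [exact HI|].
  intros l m Hl Hm.
  assert (HD := cint_plus _ _ _ _ _ _
     (cint_plus _ _ _ _ _ _ (HI m) (cint_scal (- RtoC 1) _ _ _ _ (HI l)))
     (cint_scal (RtoC (m - l) * w) _ _ _ _ (cint_exp_line p d b w l A B Hw AB))).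
  replace (I m - I l)%C with (I m + (- RtoC 1) * I l)%C by ring.
  eapply Rle_trans.
  2:{ right. instantiate (1 := scal (B - A) (K0 * (m - l) ^ 2)).
      unfold scal; simpl; unfold mult; simpl; ring. }
  refine (cint_norm_le _ (fun _ => K0 * (m - l) ^ 2) A B _ _ AB _ HD
    (is_RInt_const (V := R_NormedModule) A B _)).
  intros t Ht. unfold f. set (z := (p + RtoC t * d - b)%C).
  assert (Hz : z <> RtoC 0) by apply (Hnz t Ht).
  assert (HZ : Cmod z <= Z).
  { unfold z, Z. replace (p + RtoC t * d - b)%C with (p + - b + RtoC t * d)%C by ring.
    eapply Rle_trans; [apply Cmod_triangle|]. rewrite Cmod_mult, Cmod_R.
    assert (Cmod (p + - b)%C <= Cmod p + Cmod b).
    { eapply Rle_trans; [apply Cmod_triangle|]. rewrite Cmod_opp. lra. }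
    assert (Rabs t <= Rabs A + Rabs B).
    { pose proof (Rabs_pos A). pose proof (Rabs_pos B). pose proof (Rle_abs B).
      pose proof (Rle_abs (- A)). rewrite Rabs_Ropp in H3. apply Rabs_le. lra. }
    pose proof (Cmod_ge_0 d). nra. }
  (* The pole now divides only a second-order Taylor remainder in (m - l) z w; its two factors z
     outweigh the denominator z and leave a bound quadratic in m - l. *)
  replace (_ + _)%C with (d / z * (Cexp (- (RtoC l * (z * w)))
     * (Cexp (- (RtoC (m - l) * (z * w))) - RtoC 1 - - (RtoC (m - l) * (z * w)))))%C.
  2:{ replace (Cexp (- (RtoC m * (z * w))))%C
        with (Cexp (- (RtoC l * (z * w))) * Cexp (- (RtoC (m - l) * (z * w))))%C.
      - field. exact Hz.
      - rewrite <- Cexp_plus. f_equal. rewrite RtoC_minus. ring. }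
  rewrite !Cmod_mult, Cmod_div by exact Hz.
  assert (T := Cexp_second_order (- (RtoC (m - l) * (z * w)))%C).
  rewrite Cmod_opp, !Cmod_mult, Cmod_R, (Rabs_pos_eq (m - l)) in T by lra.
  pose proof (Cmod_ge_0 d) as Hd. pose proof (Cmod_ge_0 w) as Hw0.
  assert (Hz0 : 0 < Cmod z) by (apply Cmod_gt_0, Hz).
  assert (E : Cmod (Cexp (- (RtoC l * (z * w)))%C) <= exp (Z * Cmod w)).
  { rewrite Cmod_Cexp. apply exp_le.
    eapply Rle_trans; [apply Rle_abs|]. eapply Rle_trans; [apply re_le_Cmod|].
    rewrite Cmod_opp, !Cmod_mult, Cmod_R, Rabs_pos_eq by lra.
    assert (0 <= Cmod z * Cmod w <= Z * Cmod w) by nra. nra. }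
  assert (E2 : exp ((m - l) * (Cmod z * Cmod w)) <= exp (Z * Cmod w)).
  { apply exp_le. assert (0 <= Cmod z * Cmod w <= Z * Cmod w) by nra. nra. }
  set (X := Cmod (Cexp (- (RtoC (m - l) * (z * w))) - RtoC 1 - - (RtoC (m - l) * (z * w)))%C) in *.
  assert (HX : X <= ((m - l) * (Cmod z * Cmod w)) ^ 2 * exp (Z * Cmod w)).
  { eapply Rle_trans; [exact T|]. apply Rmult_le_compat_l; [apply pow2_ge_0 | exact E2]. }
  eapply Rle_trans.
  { apply Rmult_le_compat_l; [apply Rle_mult_inv_pos; [exact Hd | exact Hz0]|].
    apply Rmult_le_compat; [apply Cmod_ge_0 | apply Cmod_ge_0 | exact E | exact HX]. }
  unfold K0. replace (2 * (Z * Cmod w)) with (Z * Cmod w + Z * Cmod w) by ring.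
  rewrite exp_plus.
  replace (Cmod d / Cmod z * (exp (Z * Cmod w) * (((m - l) * (Cmod z * Cmod w)) ^ 2 * exp (Z * Cmod w))))
    with (Cmod z * (Cmod d * Cmod w ^ 2 * (exp (Z * Cmod w) * exp (Z * Cmod w)) * (m - l) ^ 2))
    by (field; lra).
  replace (Cmod d * (Z * Cmod w ^ 2) * (exp (Z * Cmod w) * exp (Z * Cmod w)) * (m - l) ^ 2)
    with (Z * (Cmod d * Cmod w ^ 2 * (exp (Z * Cmod w) * exp (Z * Cmod w)) * (m - l) ^ 2)) by ring.
  apply Rmult_le_compat_r; [|exact HZ].
  repeat apply Rmult_le_pos; try lra; try (left; apply exp_pos); try (simpl; nra).
Qed.

(** Seen from b, each leg of the triangle subtends the difference of the first two arctangents (the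
    foot of the perpendicular is at distance r cos eps from the origin, its length is r sin eps),
    and the far side subtends twice the third. The claim is half of the full turn 2 pi. *)
Lemma atan_triangle (r eps T : R) :
  0 < r -> 0 < eps < PI / 2 -> r < T * cos eps ->
  atan ((T - r * cos eps) / (r * sin eps)) - atan ((0 - r * cos eps) / (r * sin eps))
  + atan (T * sin eps / (T * cos eps - r)) = PI.
Proof.
  intros Hr He HT.
  assert (Hc : 0 < cos eps) by (apply cos_gt_0; lra).
  assert (Hs : 0 < sin eps) by (apply sin_gt_0; lra).
  assert (Hcs : sin eps * sin eps + cos eps * cos eps = 1) by apply sin2_cos2.
  assert (E0 : atan ((0 - r * cos eps) / (r * sin eps)) = eps - PI / 2).
  { rewrite <- (atan_tan (eps - PI / 2)) by lra. f_equal. unfold tan.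
    replace (eps - PI / 2) with (- (PI / 2 - eps)) by ring.
    rewrite sin_neg, cos_neg, sin_shift, cos_shift. field. lra. }
  set (q := (T - r * cos eps) / (r * sin eps)).
  assert (Hq : sin eps < q * cos eps).
  { unfold q. apply (Rmult_lt_reg_r (r * sin eps)); [nra|].
    replace ((T - r * cos eps) / (r * sin eps) * cos eps * (r * sin eps))
      with ((T - r * cos eps) * cos eps) by (field; lra). nra. }
  pose proof (atan_bound q) as Hb.
  (* This brings pi/2 + eps - atan q below pi/2, into the range of [atan_tan]; it expresses that the
     far side lies beyond b. *)
  assert (Hqe : eps < atan q).
  { rewrite <- (atan_tan eps) by lra. apply atan_increasing. unfold tan.
    apply (Rmult_lt_reg_r (cos eps)); [exact Hc|]. unfold Rdiv.
    rewrite Rmult_assoc, Rinv_l by lra. lra. }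
  assert (E1 : atan (T * sin eps / (T * cos eps - r)) = PI / 2 + eps - atan q).
  { rewrite <- (atan_tan (PI / 2 + eps - atan q)) by lra. f_equal. unfold tan.
    replace (PI / 2 + eps - atan q) with (PI / 2 - (atan q - eps)) by ring.
    rewrite sin_shift, cos_shift, sin_minus, cos_minus.
    assert (Hcq : 0 < cos (atan q)) by (apply cos_gt_0; lra).
    assert (Hsq : sin (atan q) = q * cos (atan q)).
    { rewrite <- (tan_atan q) at 2. unfold tan. field. lra. }
    rewrite Hsq.
    replace ((cos (atan q) * cos eps + q * cos (atan q) * sin eps) /
             (q * cos (atan q) * cos eps - cos (atan q) * sin eps))
      with ((cos eps + q * sin eps) / (q * cos eps - sin eps)) by (field; split; nra).
    assert (Hq' : q * (r * sin eps) = T - r * cos eps) by (unfold q; field; lra).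
    assert (D1 : 0 < T * cos eps - r) by lra.
    assert (D2 : 0 < q * cos eps - sin eps) by lra.
    apply (Rmult_eq_reg_r ((T * cos eps - r) * (q * cos eps - sin eps))); [|nra].
    field_simplify; [|lra|lra].
    apply (Rmult_eq_reg_r r); [|lra].
    replace T with (r * cos eps + q * (r * sin eps)) by lra.
    replace (r * cos eps + q * (r * sin eps)) with (r * (cos eps + q * sin eps)) by ring.
    set (c := cos eps) in *. set (s := sin eps) in *.
    assert (Es : s * s = 1 - c * c) by lra.
    ring_simplify. replace (s ^ 3) with (s * (s * s)) by ring. replace (s ^ 2) with (s * s) by ring.
    rewrite !Es. ring. }
  fold q. rewrite E0, E1. lra.
Qed.

(** The form e^(-zeta w)/(zeta - b) d zeta pulled back to the ray zeta = t e, used with w = 1/x and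
    b = beta1 - beta2. *)
Definition kern (e w b : C) (t : R) : C :=
  (Cexp (- (RtoC t * (e * w))) * e / (RtoC t * e - b))%C.

(** Once e0 is cancelled the two integrands are complex conjugates, so their difference is 2i times
    an imaginary part: the logarithms of the two legs cancel and an arctangent remains. *)
Lemma leg_difference (e0 : C) (r eps T : R) :
  e0 <> RtoC 0 -> 0 < r -> 0 < eps < PI / 2 -> 0 <= T ->
  let em := (e0 * (RtoC (cos eps) - Ci * RtoC (sin eps)))%C in
  let ep := (e0 * (RtoC (cos eps) + Ci * RtoC (sin eps)))%C in
  let b := (RtoC r * e0)%C in
  cint (fun t => em / (RtoC t * em - b) - ep / (RtoC t * ep - b))%C 0 T
    (RtoC 2 * Ci * RtoC (atan ((T - r * cos eps) / (r * sin eps)) - atan ((0 - r * cos eps) / (r *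
        sin eps))))%C.
Proof.
  intros He0 Hr He HT em ep b.
  assert (Hc : 0 < cos eps) by (apply cos_gt_0; lra).
  assert (Hs : 0 < sin eps) by (apply sin_gt_0; lra).
  assert (Hcs : sin eps * sin eps + cos eps * cos eps = 1) by apply sin2_cos2.
  set (c := cos eps) in *. set (s := sin eps) in *.
  set (g := fun t => r * s / ((t - r * c) ^ 2 + (r * s) ^ 2)).
  assert (Hrs : 0 < r * s) by nra.
  assert (Hden : forall t, 0 < (t - r * c) ^ 2 + (r * s) ^ 2).
  { intros t. pose proof (pow2_ge_0 (t - r * c)). nra. }
  assert (HD : forall t, is_derive (fun t => atan ((t - r * c) / (r * s))) t (g t)).
  { intros t. unfold g. auto_derive; [exact I|]. specialize (Hden t). field.
    repeat split; try lra; try nra. }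
  assert (Hg : forall t, continuous g t).
  { intros t. rapply @ex_derive_continuous. unfold g. auto_derive. specialize (Hden t). simpl in
      Hden. lra. }
  apply (cint_ext (fun t => (RtoC 2 * Ci) * RtoC (g t))%C); [exact HT | |].
  - intros t _. unfold g, em, ep, b.
    assert (N1 : (RtoC t * (RtoC c - Ci * RtoC s) - RtoC r)%C <> RtoC 0).
    { intros E. assert (E1 := f_equal Im E). assert (E2 := f_equal Re E). simpl in E1, E2.
      assert (Et : t = 0) by nra. rewrite Et in E2. lra. }
    assert (N2 : (RtoC t * (RtoC c + Ci * RtoC s) - RtoC r)%C <> RtoC 0).
    { intros E. assert (E1 := f_equal Im E). assert (E2 := f_equal Re E). simpl in E1, E2.
      assert (Et : t = 0) by nra. rewrite Et in E2. lra. }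
    replace (RtoC t * (e0 * (RtoC c - Ci * RtoC s)) - RtoC r * e0)%C
      with (e0 * (RtoC t * (RtoC c - Ci * RtoC s) - RtoC r))%C by ring.
    replace (RtoC t * (e0 * (RtoC c + Ci * RtoC s)) - RtoC r * e0)%C
      with (e0 * (RtoC t * (RtoC c + Ci * RtoC s) - RtoC r))%C by ring.
    specialize (Hden t).
    replace (e0 * (RtoC c - Ci * RtoC s) / (e0 * (RtoC t * (RtoC c - Ci * RtoC s) - RtoC r))
      - e0 * (RtoC c + Ci * RtoC s) / (e0 * (RtoC t * (RtoC c + Ci * RtoC s) - RtoC r)))%C
      with (RtoC 2 * Ci * (RtoC r * RtoC s) / ((RtoC t * (RtoC c - Ci * RtoC s) - RtoC r) * (RtoC t
          * (RtoC c + Ci * RtoC s) - RtoC r)))%C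
      by (field; repeat split; assumption).
    replace ((RtoC t * (RtoC c - Ci * RtoC s) - RtoC r) * (RtoC t * (RtoC c + Ci * RtoC s) - RtoC r))%C
      with (RtoC ((t - r * c) ^ 2 + (r * s) ^ 2)).
    + rewrite RtoC_div, RtoC_mult by lra. unfold Cdiv. ring.
    + apply C_ext; simpl; [|ring].
      replace ((t - r * c) * ((t - r * c) * 1) + r * s * (r * s * 1))
        with (t * t - 2 * t * r * c + r * r * (s * s + c * c)) by ring.
      rewrite Hcs.
      match goal with |- _ = ?X => replace X with (t * t * (s * s + c * c) - 2 * t * r * c + r * r)
          by ring end.
      rewrite Hcs. ring.
  - apply cint_scal. rewrite RtoC_minus.
    apply (cint_ftc (fun t => RtoC (atan ((t - r * c) / (r * s))))); [exact HT | |].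
    + intros t _. apply cder_RtoC, HD.
    + intros t _. split; simpl; [apply Hg | apply continuous_const].
Qed.

(** A primitive is the principal branch of log(X - r + iy), which exists because X > r. Its real
    part is even in y and cancels between the ends; its imaginary part is odd and counts twice. *)
Lemma cross_segment (e0 : C) (r X Y : R) :
  e0 <> RtoC 0 -> r < X -> 0 <= Y ->
  cint (fun y => e0 * Ci / (e0 * RtoC X + RtoC y * (e0 * Ci) - RtoC r * e0))%C (- Y) Y
    (RtoC 2 * Ci * RtoC (atan (Y / (X - r))))%C.
Proof.
  intros He HX HY.
  set (F := fun y : R => (ln ((X - r) ^ 2 + y ^ 2) / 2, atan (y / (X - r))) : C).
  set (g := fun y : R => (y / ((X - r) ^ 2 + y ^ 2), (X - r) / ((X - r) ^ 2 + y ^ 2)) : C).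
  assert (Hd : forall y, 0 < (X - r) ^ 2 + y ^ 2).
  { intros y. pose proof (pow2_ge_0 y). assert (0 < (X - r) ^ 2) by (apply pow_lt; lra). lra. }
  apply (cint_ext g); [lra | |].
  - intros y _. replace (e0 * RtoC X + RtoC y * (e0 * Ci) - RtoC r * e0)%C
      with (e0 * (RtoC (X - r) + RtoC y * Ci))%C by (rewrite RtoC_minus; ring).
    assert (N : (RtoC (X - r) + RtoC y * Ci)%C <> RtoC 0).
    { intros E. apply (f_equal Re) in E. simpl in E. lra. }
    replace (e0 * Ci / (e0 * (RtoC (X - r) + RtoC y * Ci)))%C
      with (Ci / (RtoC (X - r) + RtoC y * Ci))%C by (field; split; assumption).
    specialize (Hd y).
    apply C_ext; unfold g; simpl; field; simpl in Hd; nra.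
  - replace (RtoC 2 * Ci * RtoC (atan (Y / (X - r))))%C with (F Y - F (- Y)%R)%C.
    + apply cint_ftc; [lra | |].
      * intros y _. specialize (Hd y). split; simpl.
        -- auto_derive; [simpl in Hd; lra|]. field. simpl in Hd; lra.
        -- auto_derive; [exact I|]. field. simpl in Hd. split; nra.
      * intros y _. specialize (Hd y). split; simpl; rapply @ex_derive_continuous; auto_derive;
          simpl in Hd; lra.
    + replace (- Y / (X - r)) with (- (Y / (X - r))) by (field; lra).
      apply C_ext; unfold F; simpl.
      * replace (- Y * (- Y * 1)) with (Y * (Y * 1)) by ring. ring.
      * replace (- Y / (X - r)) with (- (Y / (X - r))) by (field; lra). rewrite atan_opp. ring.
Qed.

(** The path goes out along the leg at -eps, across, and back along the leg at +eps, hence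
    counterclockwise around b. Multiplied by e^(bw) the integrand has residue 1 at b for every value
    of the deformation parameter, and at parameter 0 the integral is elementary. *)
Lemma triangle_residue (e0 w : C) (r eps T : R) (Jm Jp Js : C) :
  e0 <> RtoC 0 -> w <> RtoC 0 -> 0 < r -> 0 < eps < PI / 2 -> r < T * cos eps ->
  let em := (e0 * (RtoC (cos eps) - Ci * RtoC (sin eps)))%C in
  let ep := (e0 * (RtoC (cos eps) + Ci * RtoC (sin eps)))%C in
  let b := (RtoC r * e0)%C in
  let p := (e0 * RtoC (T * cos eps))%C in
  let d := (e0 * Ci)%C in
  cint (kern em w b) 0 T Jm -> cint (kern ep w b) 0 T Jp ->
  cint (fun y => Cexp (- ((p + RtoC y * d) * w)) * d / (p + RtoC y * d - b))%C
    (- (T * sin eps)) (T * sin eps) Js ->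
  (Jm + Js - Jp = RtoC 2 * Ci * RtoC PI * Cexp (- (b * w)))%C.
Proof.
  intros He0 Hw Hr He HTr em ep b p d HJm HJp HJs.
  assert (Hc : 0 < cos eps) by (apply cos_gt_0; lra).
  assert (Hs : 0 < sin eps) by (apply sin_gt_0; lra).
  assert (HT : 0 < T) by nra.
  assert (HY : 0 < T * sin eps) by nra.
  assert (Nm : forall t, (RtoC 0 + RtoC t * em - b)%C <> RtoC 0).
  { intros t. replace (RtoC 0 + RtoC t * em - b)%C
      with (e0 * (RtoC t * (RtoC (cos eps) - Ci * RtoC (sin eps)) - RtoC r))%C by (unfold em, b; ring).
    apply Cmult_neq_0; [exact He0|]. intros E.
    assert (E1 := f_equal Im E). assert (E2 := f_equal Re E). simpl in E1, E2.
    assert (Et : t = 0) by nra. rewrite Et in E2. lra. }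
  assert (Np : forall t, (RtoC 0 + RtoC t * ep - b)%C <> RtoC 0).
  { intros t. replace (RtoC 0 + RtoC t * ep - b)%C
      with (e0 * (RtoC t * (RtoC (cos eps) + Ci * RtoC (sin eps)) - RtoC r))%C by (unfold ep, b; ring).
    apply Cmult_neq_0; [exact He0|]. intros E.
    assert (E1 := f_equal Im E). assert (E2 := f_equal Re E). simpl in E1, E2.
    assert (Et : t = 0) by nra. rewrite Et in E2. lra. }
  assert (Ns : forall t, (p + RtoC t * d - b)%C <> RtoC 0).
  { intros t. replace (p + RtoC t * d - b)%C
      with (e0 * (RtoC (T * cos eps) + Ci * RtoC t - RtoC r))%C by (unfold p, d, b; ring).
    apply Cmult_neq_0; [exact He0|]. intros E.
    assert (E2 := f_equal Re E). simpl in E2. lra. }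
  destruct (segment_deformation (RtoC 0) em b w 0 T Hw ltac:(lra) (fun t _ => Nm t)) as (Fm & Km &
      Fm1 & Fm2).
  destruct (segment_deformation (RtoC 0) ep b w 0 T Hw ltac:(lra) (fun t _ => Np t)) as (Fp & Kp &
      Fp1 & Fp2).
  destruct (segment_deformation p d b w (- (T * sin eps)) (T * sin eps) Hw ltac:(lra) (fun t _ =>
      Ns t)) as (Fs & Ks & Fs1 & Fs2).
  set (Phi := fun l => (Fm l + Fs l - Fp l)%C).
  assert (HPhi : Phi 1 = Phi 0).
  { apply (quadratic_increments_const Phi (Km + Kp + Ks)). intros l m Hl Hm.
    specialize (Fm2 l m Hl Hm). specialize (Fp2 l m Hl Hm). specialize (Fs2 l m Hl Hm).
    (* The ends of the cross segment are the far vertices of the legs, so the [exp_prim] terms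
       cancel around the triangle and only the quadratic remainders survive. *)
    replace (p + RtoC (- (T * sin eps)) * d)%C with (RtoC 0 + RtoC T * em)%C in Fs2
      by (unfold p, d, em; rewrite RtoC_opp, !RtoC_mult; ring).
    replace (p + RtoC (T * sin eps) * d)%C with (RtoC 0 + RtoC T * ep)%C in Fs2
      by (unfold p, d, ep; rewrite !RtoC_mult; ring).
    replace (RtoC 0 + RtoC 0 * em)%C with (RtoC 0) in Fm2 by ring.
    replace (RtoC 0 + RtoC 0 * ep)%C with (RtoC 0) in Fp2 by ring.
    match type of Fm2 with Cmod ?A <= _ => set (DA := A) in * end.
    match type of Fp2 with Cmod ?A <= _ => set (DB := A) in * end.
    match type of Fs2 with Cmod ?A <= _ => set (DC := A) in * end.
    replace (Phi m - Phi l)%C with ((DA + DC) + - DB)%C by (unfold Phi, DA, DB, DC; ring).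
    eapply Rle_trans; [apply Cmod_triangle|]. rewrite Cmod_opp.
    pose proof (Cmod_triangle DA DC). lra. }
  assert (E1 : Phi 1 = (Cexp (b * w) * (Jm + Js - Jp))%C).
  { assert (Sc : forall z, Cexp (- (RtoC 1 * ((z - b) * w)))%C = (Cexp (b * w) * Cexp (- (z * w)))%C).
    { intros z. rewrite <- Cexp_plus. f_equal. ring. }
    assert (Em : Fm 1 = (Cexp (b * w) * Jm)%C).
    { eapply cint_unique; [apply Fm1|].
      eapply cint_ext; [lra | | apply cint_scal, HJm]. intros t _. cbv beta. unfold kern.
      rewrite Sc. replace ((RtoC 0 + RtoC t * em) * w)%C with (RtoC t * (em * w))%C by ring.
      rewrite Cplus_0_l. unfold Cdiv; ring. }
    assert (Ep : Fp 1 = (Cexp (b * w) * Jp)%C).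
    { eapply cint_unique; [apply Fp1|].
      eapply cint_ext; [lra | | apply cint_scal, HJp]. intros t _. cbv beta. unfold kern.
      rewrite Sc. replace ((RtoC 0 + RtoC t * ep) * w)%C with (RtoC t * (ep * w))%C by ring.
      rewrite Cplus_0_l. unfold Cdiv; ring. }
    assert (Es : Fs 1 = (Cexp (b * w) * Js)%C).
    { eapply cint_unique; [apply Fs1|].
      eapply cint_ext; [lra | | apply cint_scal, HJs]. intros t _. cbv beta.
      rewrite Sc. unfold Cdiv; ring. }
    unfold Phi. rewrite Em, Ep, Es. ring. }
  (* At parameter 0 the exponential is 1, and the three arctangents of [atan_triangle] add up to
     pi. *)
  assert (E0 : Phi 0 = (RtoC 2 * Ci * RtoC PI)%C).
  { assert (Sc : forall z, Cexp (- (RtoC 0 * z))%C = RtoC 1).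
    { intros z. rewrite <- Cexp_0. f_equal. ring. }
    assert (D1 := cint_plus _ _ _ _ _ _ (Fm1 0) (cint_scal (- RtoC 1) _ _ _ _ (Fp1 0))).
    assert (D2 := leg_difference e0 r eps T He0 Hr He ltac:(lra)). cbv zeta in D2. fold em ep b in D2.
    assert (D3 := cross_segment e0 r (T * cos eps) (T * sin eps) He0 HTr ltac:(lra)).
    assert (X1 : (Fm 0 + (- RtoC 1) * Fp 0)%C = (RtoC 2 * Ci * RtoC (atan ((T - r * cos eps) / (r *
        sin eps)) - atan ((0 - r * cos eps) / (r * sin eps))))%C).
    { eapply cint_unique; [exact D1|]. eapply cint_ext; [lra | | exact D2].
      intros t _. cbv beta. rewrite !Sc, !Cplus_0_l. unfold Cdiv; ring. }
    assert (X2 : Fs 0 = (RtoC 2 * Ci * RtoC (atan (T * sin eps / (T * cos eps - r))))%C).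
    { eapply cint_unique; [apply Fs1|]. eapply cint_ext; [lra | | exact D3].
      intros t _. cbv beta. fold d p b. rewrite !Sc. unfold Cdiv; ring. }
    unfold Phi. replace (Fm 0 + Fs 0 - Fp 0)%C with ((Fm 0 + (- RtoC 1) * Fp 0) + Fs 0)%C by ring.
    rewrite X1, X2, <- (atan_triangle r eps T Hr He HTr), RtoC_plus. ring. }
  rewrite E0, E1 in HPhi. rewrite Cexp_neg.
  rewrite <- HPhi. field. apply Cexp_nz.
Qed.

(** Re(zeta w) is affine on the segment, so it is at least a T there because it is at both ends.
    Moreover |zeta - b| >= T cos eps - r >= T cos eps / 2, and the length 2 T sin eps against 2/(T
    cos eps) gives the constant. *)
Lemma cross_segment_small (e0 w : C) (r eps T a : R) (Js : C) :
  Cmod e0 = 1 -> 0 < eps < PI / 2 -> 0 < r -> 0 < T -> 2 * r <= T * cos eps ->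
  let em := (e0 * (RtoC (cos eps) - Ci * RtoC (sin eps)))%C in
  let ep := (e0 * (RtoC (cos eps) + Ci * RtoC (sin eps)))%C in
  let b := (RtoC r * e0)%C in
  let p := (e0 * RtoC (T * cos eps))%C in
  let d := (e0 * Ci)%C in
  a <= Re (em * w)%C -> a <= Re (ep * w)%C ->
  cint (fun y => Cexp (- ((p + RtoC y * d) * w)) * d / (p + RtoC y * d - b))%C
    (- (T * sin eps)) (T * sin eps) Js ->
  Cmod Js <= 4 * sin eps / cos eps * exp (- (a * T)).
Proof.
  intros H1 He Hr HT Hbig em ep b p d Hm Hp HJ.
  assert (Hc : 0 < cos eps) by (apply cos_gt_0; lra).
  assert (Hs : 0 < sin eps) by (apply sin_gt_0; lra).
  assert (HTc : 0 < T * cos eps) by nra. assert (HTs : 0 < T * sin eps) by nra.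
  eapply Rle_trans.
  2:{ right. instantiate (1 := scal (T * sin eps - - (T * sin eps)) (2 / (T * cos eps) * exp (- (a
      * T)))).
      unfold scal; simpl; unfold mult; simpl; field. split; lra. }
  refine (cint_norm_le _ (fun _ => 2 / (T * cos eps) * exp (- (a * T))) _ _ _ _ _ _ HJ
    (is_RInt_const (V := R_NormedModule) _ _ _)); [lra|].
  intros y Hy.
  set (z := (RtoC (T * cos eps - r) + RtoC y * Ci)%C).
  assert (Hz : T * cos eps / 2 <= Cmod z).
  { eapply Rle_trans; [|apply (re_le_Cmod z)]. eapply Rle_trans; [|apply Rle_abs].
    unfold z; simpl. lra. }
  replace (p + RtoC y * d - b)%C with (e0 * z)%C
    by (unfold z, p, d, b; rewrite RtoC_minus; ring).
  assert (Hz0 : (e0 * z)%C <> RtoC 0).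
  { apply Cmod_gt_0. rewrite Cmod_mult, H1. lra. }
  rewrite Cmod_div, !Cmod_mult, H1, Cmod_Cexp by exact Hz0. unfold d. rewrite Cmod_mult, H1.
  replace (Cmod Ci) with 1.
  2:{ unfold Cmod, Ci; simpl. rewrite <- sqrt_1 at 1. f_equal; ring. }
  rewrite !Rmult_1_l, !Rmult_1_r.
  set (u := Re (e0 * w)%C). set (v := Im (e0 * w)%C).
  assert (Em : Re (em * w)%C = cos eps * u + sin eps * v) by (unfold em, u, v; simpl; ring).
  assert (Ep : Re (ep * w)%C = cos eps * u - sin eps * v) by (unfold ep, u, v; simpl; ring).
  assert (Ee : Re (- ((p + RtoC y * (e0 * Ci)) * w))%C = - (T * cos eps * u - y * v))
    by (unfold p, u, v; simpl; ring).
  rewrite Ee.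
  assert (Hexp : exp (- (T * cos eps * u - y * v)) <= exp (- (a * T))).
  { apply exp_le. rewrite Em in Hm. rewrite Ep in Hp.
    assert (- (T * sin eps) <= y <= T * sin eps) by exact Hy.
    destruct (Rle_dec 0 v).
    - assert (y * v <= T * sin eps * v) by (apply Rmult_le_compat_r; lra).
      assert (a * T <= (cos eps * u - sin eps * v) * T) by (apply Rmult_le_compat_r; lra). lra.
    - assert ((T * sin eps) * v <= (- y) * v) by nra.
      assert (a * T <= (cos eps * u + sin eps * v) * T) by (apply Rmult_le_compat_r; lra). lra. }
  unfold Rdiv. rewrite Rmult_comm.
  apply Rmult_le_compat; [left; apply Rinv_0_lt_compat; lra | left; apply exp_pos | | exact Hexp].
  replace (2 * / (T * cos eps)) with (/ (T * cos eps / 2)) by (field; lra).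
  apply Rinv_le_contravar; lra.
Qed.

(** Let T grow in [triangle_residue]: the legs tend to the two Laplace integrals, and the far side
    decays like e^(-aT), where a is the smaller of the two decay rates. *)
Lemma stokes_exp (e0 w : C) (r eps : R) (Jm Jp : C) :
  Cmod e0 = 1 -> 0 < r -> 0 < eps < PI / 2 ->
  let em := (e0 * (RtoC (cos eps) - Ci * RtoC (sin eps)))%C in
  let ep := (e0 * (RtoC (cos eps) + Ci * RtoC (sin eps)))%C in
  let b := (RtoC r * e0)%C in
  0 < Re (em * w)%C -> 0 < Re (ep * w)%C ->
  cimp (kern em w b) Jm -> cimp (kern ep w b) Jp ->
  (Jm - Jp = RtoC 2 * Ci * RtoC PI * Cexp (- (b * w)))%C.
Proof.
  intros H1 Hr He em ep b Hm Hp (Im & HIm & Lm) (Ip & HIp & Lp).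
  assert (Hc : 0 < cos eps) by (apply cos_gt_0; lra).
  assert (Hs : 0 < sin eps) by (apply sin_gt_0; lra).
  assert (He0 : e0 <> RtoC 0) by (intros E; rewrite E, Cmod_0 in H1; lra).
  assert (Hw : w <> RtoC 0).
  { intros E. rewrite E, Cmult_0_r in Hm. simpl in Hm. lra. }
  set (a := Rmin (Re (em * w)%C) (Re (ep * w)%C)).
  assert (Ha : 0 < a) by (apply Rmin_pos; assumption).
  set (Gam := (RtoC 2 * Ci * RtoC PI * Cexp (- (b * w)))%C).
  assert (HB : forall eta, 0 < eta -> Cmod (Jm - Jp - Gam)%C <= 0 + eta).
  { intros eta Heta.
    destruct (Lm (eta / 3)) as (A & HA & HA'); [lra|].
    destruct (Lp (eta / 3)) as (B & HB & HB'); [lra|].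
    destruct (exp_neg_small (4 * sin eps / cos eps) a (eta / 3) Ha) as (D & HD & HD').
    { apply Rle_mult_inv_pos; lra. } { lra. }
    (* Beyond the three thresholds, and far enough for 2r <= T cos eps, which [cross_segment_small]
       asks for. *)
    set (T := A + B + D + 2 * r / cos eps).
    assert (Hr2 : 0 < 2 * r / cos eps) by (apply Rdiv_lt_0_compat; lra).
    assert (HT0 : 0 < T) by (unfold T; lra).
    assert (HTc : 2 * r <= T * cos eps).
    { replace (2 * r) with (2 * r / cos eps * cos eps) by (field; lra).
      apply Rmult_le_compat_r; [lra | unfold T; lra]. }
    set (p := (e0 * RtoC (T * cos eps))%C). set (d := (e0 * Ci)%C).
    assert (Hseg : exists Js, cint (fun y => Cexp (- ((p + RtoC y * d) * w)) * d / (p + RtoC y * d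
        - b))%C
       (- (T * sin eps)) (T * sin eps) Js).
    { apply cint_cont; [nra|]. intros y _. unfold Cdiv. apply ccont_mult; [apply ccont_mult|].
      - eapply cder_ccont, cder_Cexp.
        eapply (cder_ext (fun s => - (p * w) + RtoC s * (- (d * w)))%C); [intros; ring | apply
            cder_line].
      - apply ccont_const.
      - apply ccont_inv.
        + eapply (ccont_ext (fun s => (p - b) + RtoC s * d)%C); [intros; ring|].
          eapply cder_ccont, cder_line.
        + replace (p + RtoC y * d - b)%C with (e0 * (RtoC (T * cos eps - r) + RtoC y * Ci))%C
            by (unfold p, d, b; rewrite RtoC_minus; ring).
          apply Cmult_neq_0; [exact He0|]. intros E. apply (f_equal Re) in E. simpl in E. lra. }
    destruct Hseg as [Js HJs].
    assert (R := triangle_residue e0 w r eps T (Im T) (Ip T) Js He0 Hw Hr He ltac:(lra)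
       (HIm T ltac:(lra)) (HIp T ltac:(lra)) HJs). fold b in R. fold Gam in R.
    assert (S := cross_segment_small e0 w r eps T a Js H1 He Hr HT0 HTc (Rmin_l _ _) (Rmin_r _ _) HJs).
    specialize (HD' T ltac:(unfold T; lra)). specialize (HA' T ltac:(unfold T; lra)).
    specialize (HB' T ltac:(unfold T; lra)).
    replace (Jm - Jp - Gam)%C with (- (Im T - Jm) + (Ip T - Jp) + - Js)%C by (rewrite <- R; ring).
    eapply Rle_trans; [apply Cmod_triangle|]. rewrite Cmod_opp.
    assert (X := Cmod_triangle (- (Im T - Jm))%C (Ip T - Jp)%C). rewrite Cmod_opp in X. lra. }
  apply Ceq_minus, Cmod_eq_0. apply Rle_antisym; [apply Rle_plus_epsilon, HB | apply Cmod_ge_0].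
Qed.

(** * Moments of the kernel with a pole, and the jump of the Laplace integral of u *)

(** The recursion is zeta^(k+1)/(zeta - b) = zeta^k + b zeta^k/(zeta - b) under the integral. The
    direction enters only through the zeroth moment J. *)
Fixpoint kern_moment (w b J : C) (k : nat) : C :=
  match k with
  | O => J
  | S k => (RtoC (INR (fact k)) / w ^ S k + b * kern_moment w b J k)%C
  end.

Lemma cimp_kern_moment (e w b J : C) (k : nat) :
  e <> RtoC 0 -> 0 < Re (e * w)%C -> (forall t, 0 <= t -> (RtoC t * e)%C <> b) ->
  cimp (kern e w b) J -> cimp (fun t => (RtoC t * e) ^ k * kern e w b t)%C (kern_moment w b J k).
Proof.
  intros He Hw Hb HJ. induction k as [|k IH].
  - apply (cimp_ext (kern e w b)); [|exact HJ]. intros t _. simpl; ring.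
  - simpl kern_moment.
    apply (cimp_ext (fun t => (RtoC t * e) ^ k * (Cexp (- (RtoC t * (e * w))) * e)
       + b * ((RtoC t * e) ^ k * kern e w b t))%C).
    + intros t Ht. unfold kern. rewrite Cpow_S. field.
      apply Cminus_eq_contra, Hb, Ht.
    + apply cimp_plus; [apply ray_moment; assumption | apply cimp_scal, IH].
Qed.

Lemma kern_moment_diff (w b J J' : C) (k : nat) :
  (kern_moment w b J k - kern_moment w b J' k = b ^ k * (J - J'))%C.
Proof.
  induction k as [|k IH]; [simpl; ring|].
  simpl kern_moment. rewrite Cpow_S, <- Cmult_assoc, <- IH. ring.
Qed.

(** Multiplication by the conjugate of e turns the ray into [0, +oo) and preserves distances. If the
    image z of b is not real, |Im z| is a lower bound; otherwise z is negative and -Re z is one. *)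
Lemma ray_separation (e b : C) :
  Cmod e = 1 -> (forall t, 0 <= t -> (RtoC t * e)%C <> b) ->
  exists m, 0 < m /\ forall t, 0 <= t -> m <= Cmod (RtoC t * e - b)%C.
Proof.
  intros He Hb.
  assert (Hee : (e * Cconj e = RtoC 1)%C).
  { rewrite <- Cmod2_conj, He. f_equal; ring. }
  set (z := (b * Cconj e)%C).
  assert (Hz : forall t, Cmod (RtoC t * e - b)%C = Cmod (RtoC t - z)%C).
  { intros t. replace (RtoC t * e - b)%C with (e * (RtoC t - z))%C.
    - rewrite Cmod_mult, He. ring.
    - unfold z. replace (e * (RtoC t - b * Cconj e))%C with (RtoC t * e - b * (e * Cconj e))%C by ring.
      rewrite Hee. ring. }
  destruct (Req_dec (Im z) 0) as [H0 | H0].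
  - assert (Hneg : Re z < 0).
    { destruct (Rlt_dec (Re z) 0) as [H | H]; [exact H | exfalso].
      apply (Hb (Re z)); [lra|].
      assert (Ez : z = RtoC (Re z)) by (apply C_ext; [reflexivity | exact H0]).
      rewrite <- Ez. unfold z. rewrite <- Cmult_assoc, (Cmult_comm (Cconj e)), Hee. ring. }
    exists (- Re z). split; [lra|]. intros t Ht. rewrite Hz.
    eapply Rle_trans; [|apply re_le_Cmod]. eapply Rle_trans; [|apply Rle_abs].
    change (- Re z <= t - Re z). lra.
  - exists (Rabs (Im z)). split; [apply Rabs_pos_lt, H0|]. intros t _. rewrite Hz.
    eapply Rle_trans; [|apply im_le_Cmod]. right.
    change (Rabs (Im z) = Rabs (0 - Im z)). rewrite Rminus_0_l, Rabs_Ropp. reflexivity.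
Qed.

Lemma kern_bound (e w b : C) :
  Cmod e = 1 -> (forall t, 0 <= t -> (RtoC t * e)%C <> b) ->
  exists M, 0 <= M /\ forall t, 0 <= t -> Cmod (kern e w b t) <= M * exp (- (Re (e * w)%C * t)).
Proof.
  intros He Hb. destruct (ray_separation e b He Hb) as (m & Hm & Hsep).
  exists (/ m). split; [left; apply Rinv_0_lt_compat, Hm|]. intros t Ht.
  unfold kern. rewrite Cmod_div by (apply Cminus_eq_contra, Hb, Ht).
  rewrite Cmod_mult, He, Rmult_1_r, Cmod_exp_ray. unfold Rdiv. rewrite Rmult_comm.
  apply Rmult_le_compat_r; [left; apply exp_pos|].
  apply Rinv_le_contravar; [exact Hm | apply Hsep, Ht].
Qed.

Lemma ccont_kern (e w b : C) (t : R) : (RtoC t * e)%C <> b -> ccont (kern e w b) t.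
Proof.
  intros H. unfold kern, Cdiv. apply ccont_mult; [apply ccont_mult|].
  - eapply cder_ccont, cder_exp_ray.
  - apply ccont_const.
  - apply ccont_inv; [|apply Cminus_eq_contra, H].
    eapply (ccont_ext (fun s => - b + RtoC s * e)%C); [intros; ring|].
    eapply cder_ccont, cder_line.
Qed.

Lemma cimp_kern (e w b : C) :
  Cmod e = 1 -> 0 < Re (e * w)%C -> (forall t, 0 <= t -> (RtoC t * e)%C <> b) ->
  exists J, cimp (kern e w b) J.
Proof.
  intros He Hw Hb. destruct (kern_bound e w b He Hb) as (M & HM & HB).
  apply (cimp_exists _ M (Re (e * w)%C)); auto.
  intros t Ht. apply ccont_kern, Hb, Ht.
Qed.

Lemma cimp_ufun_kern (g e w b J : C) :
  Cmod e = 1 -> Cmod g < Re (e * w)%C -> (forall t, 0 <= t -> (RtoC t * e)%C <> b) ->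
  cimp (kern e w b) J ->
  exists l, cimp (fun t => ufun g (RtoC t * e) * kern e w b t)%C l /\
            clim (fun n => sum_n (fun k => ucoef g k * kern_moment w b J k)%C n) l.
Proof.
  intros He Hw Hb HJ. destruct (kern_bound e w b He Hb) as (M & HM & HB).
  pose proof (Cmod_ge_0 g).
  assert (He0 : e <> RtoC 0) by (intros E; rewrite E, Cmod_0 in He; lra).
  apply (cimp_ufun_lim g e (kern e w b) _ M (Re (e * w)%C)); auto.
  - intros t Ht. apply ccont_kern, Hb, Ht.
  - intros k. apply cimp_kern_moment; auto. lra.
Qed.

(** In the difference of the two termwise expansions only b^k (Jm - Jp) survives in the k-th moment,
    so the partial sums are Jm - Jp times the Taylor polynomials of u at b. *)
Lemma stokes_ufun (g e0 w : C) (r eps : R) (lm lp : C) :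
  Cmod e0 = 1 -> 0 < r -> 0 < eps < PI / 2 ->
  let em := (e0 * (RtoC (cos eps) - Ci * RtoC (sin eps)))%C in
  let ep := (e0 * (RtoC (cos eps) + Ci * RtoC (sin eps)))%C in
  let b := (RtoC r * e0)%C in
  Cmod g < Re (em * w)%C -> Cmod g < Re (ep * w)%C ->
  cimp (fun t => ufun g (RtoC t * em) * kern em w b t)%C lm ->
  cimp (fun t => ufun g (RtoC t * ep) * kern ep w b t)%C lp ->
  (lm - lp = ufun g b * (RtoC 2 * Ci * RtoC PI * Cexp (- (b * w))))%C.
Proof.
  intros H1 Hr He em ep b Hm Hp Hlm Hlp.
  assert (Hs : 0 < sin eps) by (apply sin_gt_0; lra).
  assert (Hcs : sin eps * sin eps + cos eps * cos eps = 1) by apply sin2_cos2.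
  assert (He0 : e0 <> RtoC 0) by (intros E; rewrite E, Cmod_0 in H1; lra).
  pose proof (Cmod_ge_0 g).
  assert (Hem : Cmod em = 1).
  { unfold em. rewrite Cmod_mult, H1, Rmult_1_l. unfold Cmod; simpl. transitivity (sqrt 1); [|apply
      sqrt_1].
    f_equal.
    transitivity (sin eps * sin eps + cos eps * cos eps); [ring | exact Hcs]. }
  assert (Hep : Cmod ep = 1).
  { unfold ep. rewrite Cmod_mult, H1, Rmult_1_l. unfold Cmod; simpl. transitivity (sqrt 1); [|apply
      sqrt_1].
    f_equal.
    transitivity (sin eps * sin eps + cos eps * cos eps); [ring | exact Hcs]. }
  assert (Nm : forall t, 0 <= t -> (RtoC t * em)%C <> b).
  { intros t _ E. apply Ceq_minus in E.
    replace (RtoC t * em - b)%C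
      with (e0 * (RtoC t * (RtoC (cos eps) - Ci * RtoC (sin eps)) - RtoC r))%C in E by (unfold em,
          b; ring).
    revert E. apply Cmult_neq_0; [exact He0|]. intros E.
    assert (E1 := f_equal Im E). assert (E2 := f_equal Re E). simpl in E1, E2.
    assert (Et : t = 0) by nra. rewrite Et in E2. lra. }
  assert (Np : forall t, 0 <= t -> (RtoC t * ep)%C <> b).
  { intros t _ E. apply Ceq_minus in E.
    replace (RtoC t * ep - b)%C
      with (e0 * (RtoC t * (RtoC (cos eps) + Ci * RtoC (sin eps)) - RtoC r))%C in E by (unfold ep,
          b; ring).
    revert E. apply Cmult_neq_0; [exact He0|]. intros E.
    assert (E1 := f_equal Im E). assert (E2 := f_equal Re E). simpl in E1, E2.
    assert (Et : t = 0) by nra. rewrite Et in E2. lra. }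
  destruct (cimp_kern em w b Hem ltac:(lra) Nm) as [Jm HJm].
  destruct (cimp_kern ep w b Hep ltac:(lra) Np) as [Jp HJp].
  destruct (cimp_ufun_kern g em w b Jm Hem Hm Nm HJm) as (l & Hl & Ll).
  destruct (cimp_ufun_kern g ep w b Jp Hep Hp Np HJp) as (l' & Hl' & Ll').
  rewrite (cimp_unique _ _ _ Hlm Hl), (cimp_unique _ _ _ Hlp Hl').
  assert (G := stokes_exp e0 w r eps Jm Jp H1 Hr He (Rle_lt_trans _ _ _ H Hm) (Rle_lt_trans _ _ _ H
      Hp) HJm HJp).
  fold b in G. rewrite <- G.
  apply (clim_unique (fun n => (Jm - Jp) * usum g n b)%C).
  - eapply clim_ext; [|exact (clim_minus _ _ _ _ Ll Ll')]. intros n. cbv beta.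
    unfold usum. induction n as [|n IH].
    + rewrite !sum_O. replace (ucoef g 0 * kern_moment w b Jm 0 - ucoef g 0 * kern_moment w b Jp 0)%C
        with (ucoef g 0 * (kern_moment w b Jm 0 - kern_moment w b Jp 0))%C by ring.
      rewrite kern_moment_diff. ring.
    + rewrite !sum_Sn. change plus with Cplus. rewrite Cmult_plus_distr_l, <- IH.
      replace ((Jm - Jp) * (ucoef g (S n) * b ^ S n))%C with (ucoef g (S n) * (b ^ S n * (Jm -
          Jp)))%C by ring.
      rewrite <- (kern_moment_diff w). ring.
  - rewrite Cmult_comm. apply clim_scal, usum_lim.
Qed.

(** * Complex derivatives *)

(** The codomain is C as a module over itself, the structure for which the product rule
    [is_derive_mult] is stated; [cdiff_is_derive] passes to [C_NormedModule], as used in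
    [is_Lop]. *)
Definition cdiff (f : C -> C) (x l : C) : Prop :=
  is_derive (K := C_AbsRing) (V := AbsRing_NormedModule C_AbsRing) f x l.

Lemma cdiff_is_derive (f : C -> C) (x l : C) :
  cdiff f x l -> is_derive (K := C_AbsRing) (V := C_NormedModule) f x l.
Proof. intros [[L1 L2 L3] H]. split; [constructor; assumption | exact H]. Qed.

Lemma cdiff_eq (f : C -> C) (x l l' : C) : cdiff f x l -> l = l' -> cdiff f x l'.
Proof. intros H <-; exact H. Qed.

Lemma cdiff_ext (f g : C -> C) (x l : C) : (forall z, f z = g z) -> cdiff f x l -> cdiff g x l.
Proof. intros E. apply is_derive_ext. exact E. Qed.

Lemma cdiff_const (c x : C) : cdiff (fun _ => c) x (RtoC 0).
Proof. exact (is_derive_const (K := C_AbsRing) (V := AbsRing_NormedModule C_AbsRing) c x). Qed.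

Lemma cdiff_id (x : C) : cdiff (fun z => z) x (RtoC 1).
Proof. exact (is_derive_id (K := C_AbsRing) x). Qed.

Lemma cdiff_plus (f g : C -> C) (x lf lg : C) :
  cdiff f x lf -> cdiff g x lg -> cdiff (fun z => f z + g z)%C x (lf + lg)%C.
Proof. exact (is_derive_plus (K := C_AbsRing) (V := AbsRing_NormedModule C_AbsRing) f g x lf lg). Qed.

Lemma cdiff_mult (f g : C -> C) (x lf lg : C) :
  cdiff f x lf -> cdiff g x lg -> cdiff (fun z => f z * g z)%C x (lf * g x + f x * lg)%C.
Proof. intros Hf Hg. exact (is_derive_mult (K := C_AbsRing) f g x lf lg Hf Hg Cmult_comm). Qed.

Lemma cdiff_comp (f g : C -> C) (x lf lg : C) :
  cdiff f (g x) lf -> cdiff g x lg -> cdiff (fun z => f (g z)) x (lg * lf)%C.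
Proof. exact (is_derive_comp (K := C_AbsRing) (V := AbsRing_NormedModule C_AbsRing) f g x lf lg). Qed.

Lemma cdiff_quadratic (f : C -> C) (x l : C) (eta K : R) :
  0 < eta ->
  (forall d, Cmod d < eta -> Cmod (f (x + d) - f x - d * l)%C <= K * Cmod d ^ 2) -> cdiff f x l.
Proof.
  intros Heta H. split.
  - apply (is_linear_scal_l (K := C_AbsRing) (V := AbsRing_NormedModule C_AbsRing) l).
  - intros x' Hx'.
    assert (E := is_filter_lim_locally_unique (K := C_AbsRing) (V := AbsRing_NormedModule
        C_AbsRing) x x' Hx').
    subst x'. intros eps.
    (* Within this radius K |d|^2 <= eps |d|. *)
    assert (Hk : 0 < Rmin eta (eps / (Rabs K + 1))).
    { apply Rmin_pos; [exact Heta|]. apply Rdiv_lt_0_compat; [apply cond_pos|].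
      pose proof (Rabs_pos K). lra. }
    exists (mkposreal _ Hk). 
    change (forall y : C, Cmod (y - x)%C < Rmin eta (eps / (Rabs K + 1)) ->
      Cmod (f y - f x - (y - x) * l)%C <= eps * Cmod (y - x)%C).
    intros y Hy.
    assert (H' := H (y - x)%C (Rlt_le_trans _ _ _ Hy (Rmin_l _ _))).
    replace (x + (y - x))%C with y in H' by ring.
    eapply Rle_trans; [exact H'|].
    assert (Hy' := Rlt_le_trans _ _ _ Hy (Rmin_r _ _)).
    pose proof (Cmod_ge_0 (y - x)%C). pose proof (Rabs_pos K). pose proof (Rle_abs K).
    assert (Cmod (y - x)%C * (Rabs K + 1) <= eps).
    { apply (Rmult_lt_compat_r (Rabs K + 1)) in Hy'; [|lra].
      unfold Rdiv in Hy'. rewrite Rmult_assoc, Rinv_l, Rmult_1_r in Hy' by lra. lra. }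
    simpl. nra.
Qed.

Lemma cdiff_Cexp (x : C) : cdiff Cexp x (Cexp x).
Proof.
  apply (cdiff_quadratic _ _ _ 1 (Cmod (Cexp x) * exp 1)); [lra|]. intros d Hd.
  replace (Cexp (x + d) - Cexp x - d * Cexp x)%C with (Cexp x * (Cexp d - RtoC 1 - d))%C
    by (rewrite Cexp_plus; ring).
  rewrite Cmod_mult, Rmult_assoc. apply Rmult_le_compat_l; [apply Cmod_ge_0|].
  eapply Rle_trans; [apply Cexp_second_order|]. rewrite Rmult_comm.
  apply Rmult_le_compat_r; [apply pow2_ge_0 | apply exp_le; lra].
Qed.

Lemma cdiff_exp_comp (f : C -> C) (x l : C) :
  cdiff f x l -> cdiff (fun z => Cexp (f z)) x (l * Cexp (f x))%C.
Proof. intros H. apply (cdiff_comp Cexp f); [apply cdiff_Cexp | exact H]. Qed.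

(** The remainder is exactly d^2/(x^2 (x + d)), and |x + d| >= |x|/2 for |d| < |x|/2; this gives the
    constant 2/|x|^3. *)
Lemma cdiff_inv (x : C) : x <> RtoC 0 -> cdiff Cinv x (- / (x * x))%C.
Proof.
  intros Hx. assert (Hx0 : 0 < Cmod x) by (apply Cmod_gt_0, Hx).
  apply (cdiff_quadratic _ _ _ (Cmod x / 2) (2 / Cmod x ^ 3)); [lra|]. intros d Hd.
  assert (Hxd : Cmod x / 2 <= Cmod (x + d)%C).
  { assert (T := Cmod_triangle (x + d)%C (- d)%C). rewrite Cmod_opp in T.
    replace (x + d + - d)%C with x in T by ring. lra. }
  assert (Hxd0 : (x + d)%C <> RtoC 0) by (apply Cmod_gt_0; lra).
  replace (/ (x + d) - / x - d * - / (x * x))%C with (d ^ 2 / (x ^ 2 * (x + d)))%C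
    by (field; split; assumption).
  assert (Hx2 : (x ^ 2)%C <> RtoC 0) by (apply Cpow_nz, Hx).
  rewrite Cmod_div by (apply Cmult_neq_0; assumption). rewrite Cmod_mult, !Cmod_pow.
  rewrite (Rmult_comm (2 / Cmod x ^ 3)). apply Rmult_le_compat_l; [apply pow2_ge_0|].
  replace (2 / Cmod x ^ 3) with (/ (Cmod x ^ 2 * (Cmod x / 2))) by (field; lra).
  apply Rinv_le_contravar; [assert (0 < Cmod x ^ 2) by (apply pow_lt, Hx0); nra|].
  apply Rmult_le_compat_l; [apply pow2_ge_0 | exact Hxd].
Qed.

(* Domination by exp(-c t) absorbs the factor t^2 of the second-order Taylor remainder. *)
Lemma laplace_cdiff (h : R -> C) (e w : C) (F : C -> C) (M G : R) :
  Cmod e = 1 -> 0 <= M -> G < Re (e * w)%C ->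
  (forall t, 0 <= t -> ccont h t) ->
  (forall t, 0 <= t -> Cmod (h t) <= M * exp (G * t)) ->
  (forall v, G < Re (e * v)%C -> cimp (fun t => h t * Cexp (- (RtoC t * (e * v))))%C (F v)) ->
  exists D, cimp (fun t => - (RtoC t * e) * (h t * Cexp (- (RtoC t * (e * w)))))%C D /\ cdiff F w D.
Proof.
  intros He HM Hw HC HB HF. set (a := Re (e * w)%C) in *.
  assert (Hk : forall v t, 0 <= t -> ccont (fun s => h s * Cexp (- (RtoC s * (e * v))))%C t).
  { intros v t Ht. apply ccont_mult; [apply HC, Ht | exact (cder_ccont _ _ _ (cder_exp_ray _ t))]. }
  assert (Hkb : forall t, 0 <= t -> Cmod (h t * Cexp (- (RtoC t * (e * w))))%C <= M * exp (- ((a -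
      G) * t))).
  { intros t Ht. rewrite Cmod_mult, Cmod_exp_ray. fold a.
    replace (- ((a - G) * t)) with (G * t + - (a * t)) by ring. rewrite exp_plus, <- Rmult_assoc.
    apply Rmult_le_compat_r; [left; apply exp_pos | apply HB, Ht]. }
  assert (HD : exists D, cimp (fun t => - (RtoC t * e) * (h t * Cexp (- (RtoC t * (e * w)))))%C D).
  { destruct (pow_exp_decay 1 (a - G)) as (M1 & HM1 & HB1); [lra|].
    apply (cimp_exists _ (M * M1) ((a - G) / 2)).
    - lra.
    - apply Rmult_le_pos; assumption.
    - intros t Ht. apply ccont_mult; [|apply Hk, Ht].
      eapply (ccont_ext (fun s => RtoC 0 + RtoC s * (- e))%C); [intros; ring|].
      exact (cder_ccont _ _ _ (cder_line _ _ t)).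
    - intros t Ht. rewrite Cmod_mult, Cmod_opp, Cmod_mult, He, Cmod_R, Rabs_pos_eq, Rmult_1_r by
        exact Ht.
      specialize (HB1 t Ht). rewrite pow_1 in HB1.
      eapply Rle_trans; [apply Rmult_le_compat_l; [exact Ht | apply Hkb, Ht]|].
      replace (t * (M * exp (- ((a - G) * t)))) with (M * (t * exp (- ((a - G) * t)))) by ring.
      rewrite Rmult_assoc. apply Rmult_le_compat_l; assumption. }
  destruct HD as [D HD]. exists D; split; [exact HD|].
  (* The decay e^(-(a - G) t) is split into two factors e^(-ct): one pays for e^(|d| t), as |d| < c,
     the other for t^2. *)
  set (c := (a - G) / 2). assert (Hc : 0 < c) by (unfold c; lra).
  destruct (pow_exp_decay 2 c Hc) as (M2 & HM2 & HB2).
  apply (cdiff_quadratic _ _ _ c (M * M2 / (c / 2)) Hc). intros d Hd.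
  pose proof (Cmod_ge_0 d) as Hd0.
  assert (Hwd : G < Re (e * (w + d))%C).
  { replace (e * (w + d))%C with (e * w + e * d)%C by ring. rewrite re_plus. fold a.
    assert (T := re_le_Cmod (e * d)%C). rewrite Cmod_mult, He, Rmult_1_l in T.
    pose proof (Rle_abs (- Re (e * d)%C)) as T'. rewrite Rabs_Ropp in T'. unfold c in *. lra. }
  assert (X := cimp_minus _ _ _ _ (cimp_minus _ _ _ _ (HF _ Hwd) (HF _ Hw)) (cimp_scal d _ _ HD)).
  apply (cimp_bound _ _ (M * M2 * Cmod d ^ 2) (c / 2)) in X.
  - eapply Rle_trans; [exact X|]. right. field. lra.
  - lra.
  - apply Rmult_le_pos; [apply Rmult_le_pos; assumption | apply pow2_ge_0].
  - intros t Ht.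
    replace (_ - _)%C with (h t * Cexp (- (RtoC t * (e * w)))
      * (Cexp (- (RtoC t * (e * d))) - RtoC 1 - - (RtoC t * (e * d))))%C.
    2:{ replace (Cexp (- (RtoC t * (e * (w + d)))))%C
          with (Cexp (- (RtoC t * (e * w))) * Cexp (- (RtoC t * (e * d))))%C.
        - ring.
        - rewrite <- Cexp_plus. f_equal. ring. }
    rewrite Cmod_mult.
    assert (T := Cexp_second_order (- (RtoC t * (e * d)))%C).
    rewrite Cmod_opp, !Cmod_mult, He, Cmod_R, Rmult_1_l, Rabs_pos_eq in T by exact Ht.
    eapply Rle_trans.
    { apply Rmult_le_compat; [apply Cmod_ge_0 | apply Cmod_ge_0 | apply Hkb, Ht | exact T]. }
    assert (E : exp (t * Cmod d) <= exp (c * t)) by (apply exp_le; nra).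
    specialize (HB2 t Ht).
    replace (- ((a - G) * t)) with (- (c * t) + - (c * t)) by (unfold c; field).
    rewrite exp_plus. rewrite (exp_Ropp (c * t)) at 2.
    pose proof (exp_pos (c * t)). pose proof (exp_pos (- (c * t))).
    assert (E' : / exp (c * t) * exp (t * Cmod d) <= 1).
    { apply (Rmult_le_reg_l (exp (c * t))); [assumption|].
      rewrite <- Rmult_assoc, Rinv_r, Rmult_1_l, Rmult_1_r by lra. exact E. }
    replace (M * (exp (- (c * t)) * / exp (c * t)) * ((t * Cmod d) ^ 2 * exp (t * Cmod d)))
      with (M * Cmod d ^ 2 * (t ^ 2 * exp (- (c * t))) * (/ exp (c * t) * exp (t * Cmod d))) by ring.
    replace (M * M2 * Cmod d ^ 2 * exp (- (c / 2 * t)))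
      with (M * Cmod d ^ 2 * (M2 * exp (- (c / 2 * t))) * 1) by ring.
    apply Rmult_le_compat.
    + apply Rmult_le_pos; [apply Rmult_le_pos; [exact HM | apply pow2_ge_0]|].
      apply Rmult_le_pos; [apply pow2_ge_0 | lra].
    + apply Rmult_le_pos; [left; apply Rinv_0_lt_compat; assumption | left; apply exp_pos].
    + apply Rmult_le_compat_l; [apply Rmult_le_pos; [exact HM | apply pow2_ge_0] | exact HB2].
    + exact E'.
Qed.

(** * Arguments and singular directions *)

Lemma Cexp_i (th : R) : Cexp (Ci * RtoC th)%C = (cos th, sin th).
Proof.
  unfold Cexp. apply C_ext; simpl;
    replace (0 * th - 1 * 0) with 0 by ring; replace (0 * 0 + 1 * th) with th by ring;
    rewrite exp_0; ring.
Qed.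

Lemma Cmod_Cexp_i (th : R) : Cmod (Cexp (Ci * RtoC th)%C) = 1.
Proof.
  rewrite Cmod_Cexp. replace (Re (Ci * RtoC th)%C) with 0 by (simpl; ring). apply exp_0.
Qed.

Lemma Cexp_i_plus (th eps : R) :
  Cexp (Ci * RtoC (th + eps))%C
  = (Cexp (Ci * RtoC th) * (RtoC (cos eps) + Ci * RtoC (sin eps)))%C.
Proof.
  rewrite RtoC_plus, Cmult_plus_distr_l, Cexp_plus. f_equal. rewrite Cexp_i.
  apply C_ext; simpl; ring.
Qed.

Lemma Cexp_i_minus (th eps : R) :
  Cexp (Ci * RtoC (th - eps))%C
  = (Cexp (Ci * RtoC th) * (RtoC (cos eps) - Ci * RtoC (sin eps)))%C.
Proof.
  unfold Rminus. rewrite Cexp_i_plus, cos_neg, sin_neg. f_equal.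
  rewrite RtoC_opp. ring.
Qed.

Lemma Cexp_i_period (th : R) (k : Z) :
  Cexp (Ci * RtoC (th + 2 * IZR k * PI))%C = Cexp (Ci * RtoC th)%C.
Proof.
  rewrite !Cexp_i.
  assert (Hs : sin (IZR k * PI) = 0) by (apply sin_eq_0_1; exists k; reflexivity).
  assert (E : 2 * IZR k * PI = 2 * (IZR k * PI)) by ring.
  apply C_ext; simpl; rewrite E.
  - rewrite cos_plus, cos_2a_sin, sin_2a, Hs. ring.
  - rewrite sin_plus, cos_2a_sin, sin_2a, Hs. ring.
Qed.

(** Equal sines and cosines give cos(th - th') = 1, so the sine of half the difference vanishes and
    that half is a multiple of pi. *)
Lemma Cexp_i_eq (th th' : R) :
  Cexp (Ci * RtoC th)%C = Cexp (Ci * RtoC th')%C -> exists k : Z, th = th' + 2 * IZR k * PI.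
Proof.
  rewrite !Cexp_i. intros E.
  assert (Ec : cos th = cos th') by (exact (f_equal Re E)).
  assert (Es : sin th = sin th') by (exact (f_equal Im E)).
  assert (H : cos (th - th') = 1).
  { rewrite cos_minus, Ec, Es. pose proof (sin2_cos2 th'). unfold Rsqr in *. lra. }
  replace (th - th') with (2 * ((th - th') / 2)) in H by field.
  rewrite cos_2a_sin in H.
  assert (Hs : sin ((th - th') / 2) = 0) by nra.
  apply sin_eq_0_0 in Hs. destruct Hs as [k Hk]. exists k. lra.
Qed.

(** [acos] takes values in [0, pi], so the sign of the imaginary part decides between the angle and
    its negative. *)
Lemma Arg_polar (z : C) :
  z <> RtoC 0 -> z = (RtoC (Cmod z) * Cexp (Ci * RtoC (Arg z)))%C.
Proof.
  intros Hz. assert (Hm : 0 < Cmod z) by (apply Cmod_gt_0, Hz).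
  set (x := Re z / Cmod z).
  assert (Hx : -1 <= x <= 1).
  { pose proof (re_le_Cmod z) as H. apply Rabs_le_between in H.
    unfold x. split; apply (Rmult_le_reg_r (Cmod z)); try exact Hm;
    unfold Rdiv; rewrite Rmult_assoc, Rinv_l by lra; lra. }
  assert (Hs : sin (acos x) = Rabs (Im z) / Cmod z).
  { rewrite sin_acos by exact Hx.
    replace (1 - x²) with ((Rabs (Im z) / Cmod z)²).
    - apply sqrt_Rsqr. apply Rle_mult_inv_pos; [apply Rabs_pos | exact Hm].
    - assert (Q := Cmod2_alt z). unfold x, Rsqr.
      apply (Rmult_eq_reg_r (Cmod z ^ 2)); [|assert (0 < Cmod z ^ 2) by (apply pow_lt, Hm); lra].
      field_simplify; [|lra|lra]. rewrite pow2_abs. lra. }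
  rewrite Cexp_i. unfold Arg. fold x.
  apply C_ext; destruct (Rle_dec 0 (Im z)) as [H | H]; simpl.
  - rewrite cos_acos by exact Hx. unfold x. field. lra.
  - rewrite cos_neg, cos_acos by exact Hx. unfold x. field. lra.
  - rewrite Hs, Rabs_pos_eq by exact H. field. lra.
  - rewrite sin_neg, Hs, Rabs_left by lra. field. lra.
Qed.

Lemma singular_direction0_iff (beta1 beta2 : C) (theta : R) :
  beta1 <> beta2 ->
  singular_direction0 beta1 beta2 theta <->
  exists k : Z, theta = Arg (beta1 - beta2)%C + 2 * IZR k * PI.
Proof.
  intros Hb. assert (Hb0 : (beta1 - beta2)%C <> RtoC 0) by (apply Cminus_eq_contra, Hb).
  assert (P := Arg_polar _ Hb0). assert (Hm : 0 < Cmod (beta1 - beta2)%C) by (apply Cmod_gt_0, Hb0).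
  unfold singular_direction0, laplace_den. split.
  - intros (r & Hr & E).
    assert (E' : (RtoC r * Cexp (Ci * RtoC theta))%C = (beta1 - beta2)%C).
    { apply Ceq_minus. rewrite <- E. ring. }
    assert (Er : r = Cmod (beta1 - beta2)%C).
    { rewrite <- E', Cmod_mult, Cmod_Cexp_i, Cmod_R, Rabs_pos_eq by lra. ring. }
    apply Cexp_i_eq. rewrite P in E' at 1. rewrite <- Er in E'.
    assert (Hr0 : RtoC r <> RtoC 0) by (intros X; apply RtoC_inj in X; lra).
    rewrite <- (Cmult_1_l (Cexp (Ci * RtoC theta)%C)), <- (Cinv_l _ Hr0), <- Cmult_assoc, E'.
    rewrite Cmult_assoc, (Cinv_l _ Hr0). ring.
  - intros [k ->]. exists (Cmod (beta1 - beta2)%C). split; [exact Hm|].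
    rewrite Cexp_i_period, <- P. ring.
Qed.

(** A singular direction asks for r > 0; the end t = 0 of the ray is excluded by beta1 <> beta2. *)
Lemma ray_avoids (beta1 beta2 : C) (theta : R) :
  beta1 <> beta2 -> ~ singular_direction0 beta1 beta2 theta ->
  forall t, 0 <= t -> (RtoC t * Cexp (Ci * RtoC theta))%C <> (beta1 - beta2)%C.
Proof.
  intros Hb H t Ht E. destruct Ht as [Ht | <-].
  - apply H. exists t. split; [exact Ht|]. unfold laplace_den. rewrite E. ring.
  - apply (Cminus_eq_contra _ _ Hb). rewrite <- E. ring.
Qed.

(** * The functions phi_theta and the fundamental matrices *)

Lemma phi0_value (beta1 beta2 gamma1 gamma2 : C) (theta : R) (x l : C) :
  cimp (fun t => ufun (gamma2 - gamma1) (RtoC t * Cexp (Ci * RtoC theta))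
     * kern (Cexp (Ci * RtoC theta)) (/ x) (beta1 - beta2) t)%C l ->
  phi0 beta1 beta2 gamma1 gamma2 theta x = l.
Proof.
  intros H. unfold phi0, ray_int. apply cimp_RInt_gen. revert H. apply cimp_ext. intros t _. cbv beta.
  change (laplace_u gamma1 gamma2) with (ufun (gamma2 - gamma1)%C).
  unfold kern, laplace_den, Cdiv.
  replace (RtoC t * Cexp (Ci * RtoC theta) + beta2 - beta1)%C
    with (RtoC t * Cexp (Ci * RtoC theta) - (beta1 - beta2))%C by ring.
  rewrite (Cmult_assoc (RtoC t)). ring.
Qed.

(** Put w = 1/x. Differentiation in w brings down -zeta, and zeta/(zeta - b) = 1 + b/(zeta - b)
    splits the result into the Laplace transform U of u and b phi. The chain rule factor -1/x^2
    gives x^2 phi' - b phi = U, and g U is known from [laplace_ufun]. *)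
Lemma phi0_cdiff (beta1 beta2 gamma1 gamma2 : C) (theta : R) (x : C) :
  beta1 <> beta2 -> ~ singular_direction0 beta1 beta2 theta -> dom0 gamma1 gamma2 theta x ->
  exists dphi : C, cdiff (phi0 beta1 beta2 gamma1 gamma2 theta) x dphi /\
    ((gamma2 - gamma1) * (x ^ 2 * dphi - (beta1 - beta2) * phi0 beta1 beta2 gamma1 gamma2 theta x)
     = Cexp ((gamma2 - gamma1) * x) - RtoC 1)%C.
Proof.
  intros Hb Hsing [Hx Hdom]. set (e := Cexp (Ci * RtoC theta)%C) in *.
  set (g := (gamma2 - gamma1)%C) in *. set (b := (beta1 - beta2)%C).
  assert (He : Cmod e = 1) by apply Cmod_Cexp_i.
  assert (Hray : forall t, 0 <= t -> (RtoC t * e)%C <> b) by (apply ray_avoids; assumption).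
  pose proof (Cmod_ge_0 g) as Hg0.
  destruct (ray_separation e b He Hray) as (m & Hm & Hsep).
  assert (Hm' : 0 < / m) by (apply Rinv_0_lt_compat, Hm).
  set (h := fun t => (ufun g (RtoC t * e) * (e / (RtoC t * e - b)))%C).
  (* [F] is a total function, so [HF] holds for every z, also where the integral may diverge;
     [cdiff_ext] asks for equality everywhere. *)
  set (F := fun v => RInt_gen (V := C_R_CompleteNormedModule)
     (fun t => h t * Cexp (- (RtoC t * (e * v))))%C (at_point 0) (Rbar_locally p_infty)).
  assert (HF : forall z, F (/ z)%C = phi0 beta1 beta2 gamma1 gamma2 theta z).
  { intros z. unfold F, phi0, ray_int. f_equal. apply functional_extensionality. intros t.
    change (laplace_u gamma1 gamma2) with (ufun g). fold e.
    unfold h, laplace_den, Cdiv.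
    replace (RtoC t * e + beta2 - beta1)%C with (RtoC t * e - b)%C by (unfold b; ring).
    rewrite (Cmult_assoc (RtoC t)). ring. }
  assert (HFc : forall v, Cmod g < Re (e * v)%C -> cimp (fun t => h t * Cexp (- (RtoC t * (e *
      v))))%C (F v)).
  { intros v Hv. destruct (cimp_kern e v b He ltac:(lra) Hray) as [J HJ].
    destruct (cimp_ufun_kern g e v b J He Hv Hray HJ) as (l & Hl & _).
    assert (Hl' : cimp (fun t => h t * Cexp (- (RtoC t * (e * v))))%C l).
    { revert Hl. apply cimp_ext. intros t _. unfold h, kern, Cdiv. ring. }
    unfold F. rewrite (cimp_RInt_gen _ _ Hl'). exact Hl'. }
  assert (Hw : Cmod g < Re (e * / x)%C) by exact Hdom.
  destruct (laplace_cdiff h e (/ x)%C F (3 * / m) (Cmod g) He) as (D & HD & HdF).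
  - lra.
  - exact Hw.
  - intros t Ht. apply ccont_mult; [apply ccont_ufun|]. unfold Cdiv.
    apply ccont_mult; [apply ccont_const|]. apply ccont_inv; [|apply Cminus_eq_contra, Hray, Ht].
    eapply (ccont_ext (fun s => - b + RtoC s * e)%C); [intros; ring|].
    exact (cder_ccont _ _ _ (cder_line _ _ t)).
  - intros t Ht. unfold h. rewrite Cmod_mult, Cmod_div by (apply Cminus_eq_contra, Hray, Ht).
    rewrite He. assert (H := ufun_bound g (RtoC t * e)%C).
    rewrite Cmod_mult, Cmod_R, He, Rabs_pos_eq, Rmult_1_r in H by exact Ht.
    replace (3 * / m * exp (Cmod g * t)) with (3 * exp (Cmod g * t) * / m) by ring.
    apply Rmult_le_compat; [apply Cmod_ge_0 | | exact H |].
    + apply Rle_mult_inv_pos; [lra|]. specialize (Hsep t Ht). lra.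
    + unfold Rdiv. rewrite Rmult_1_l. apply Rinv_le_contravar; [exact Hm | apply Hsep, Ht].
  - exact HFc.
  - exists (- / (x * x) * D)%C. split.
    + apply (cdiff_ext (fun z => F (/ z)%C)); [exact HF|].
      apply cdiff_comp; [exact HdF | apply cdiff_inv, Hx].
    + destruct (laplace_ufun g e (/ x)%C He Hw) as (U & HU & EU).
      assert (ED : D = (- (U + b * F (/ x)))%C).
      { apply (cimp_unique _ _ _ HD).
        replace (- (U + b * F (/ x)))%C with ((- RtoC 1) * (U + b * F (/ x)))%C by ring.
        eapply cimp_ext; [|apply cimp_scal, cimp_plus; [exact HU | apply cimp_scal, HFc, Hw]].
        intros t Ht. cbv beta. unfold h. field. apply Cminus_eq_contra, Hray, Ht. }
      rewrite <- HF, ED.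
      replace (g * x)%C with (g / / x)%C by (field; exact Hx). rewrite <- EU. field. exact Hx.
Qed.

Lemma mul2_M2 (a b c d a' b' c' d' : C) :
  mul2 (M2 a b c d) (M2 a' b' c' d')
  = M2 (a * a' + b * c')%C (a * b' + b * d')%C (c * a' + d * c')%C (c * b' + d * d')%C.
Proof.
  unfold mul2, Mmult, M2. apply mk_matrix_ext. intros i j Hi Hj.
  change (pred 2) with 1%nat. rewrite sum_Sn, sum_O, !coeff_mat_bij by lia.
  destruct i as [|i], j as [|j]; reflexivity.
Qed.

Lemma Mone_M2 : Mone (T := C_Ring) = M2 (RtoC 1) (RtoC 0) (RtoC 0) (RtoC 1).
Proof.
  unfold Mone, M2. apply mk_matrix_ext. intros i j Hi Hj.
  destruct i as [|[|i]], j as [|[|j]]; try lia; reflexivity.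
Qed.

Lemma Phi0_entries (beta1 beta2 gamma1 gamma2 : C) (theta : R) (x : C) :
  Phi0 beta1 beta2 gamma1 gamma2 theta x
  = M2 (Cexp (gamma1 * x) * Cexp (- (beta1 / x)))%C
       (Cexp (gamma1 * x) * (x ^ 2 / (beta2 - beta1)
          + (gamma2 - gamma1) * x ^ 2 * phi0 beta1 beta2 gamma1 gamma2 theta x)
          * / x ^ 2 * Cexp (- (beta2 / x)))%C
       (RtoC 0)
       (Cexp (gamma2 * x) * / x ^ 2 * Cexp (- (beta2 / x)))%C.
Proof.
  unfold Phi0, diag2, H0. rewrite !mul2_M2. f_equal; ring.
Qed.

Lemma cdiff_sqr (x : C) : cdiff (fun z => z ^ 2)%C x (RtoC 2 * x)%C.
Proof.
  eapply (cdiff_ext (fun z => z * z)%C); [intros; simpl; ring|].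
  eapply cdiff_eq; [apply cdiff_mult; apply cdiff_id|]. cbv beta; ring.
Qed.

Lemma cdiff_inv_sqr (x : C) : x <> RtoC 0 -> cdiff (fun z => / z ^ 2)%C x (- (RtoC 2 / x ^ 3))%C.
Proof.
  intros Hx. eapply cdiff_eq.
  - apply (cdiff_comp Cinv (fun z => z ^ 2)%C); [apply cdiff_inv, Cpow_nz, Hx | apply cdiff_sqr].
  - field. exact Hx.
Qed.

Lemma cdiff_exp_lin (c x : C) : cdiff (fun z => Cexp (c * z))%C x (c * Cexp (c * x))%C.
Proof.
  eapply cdiff_eq; [apply (cdiff_exp_comp (fun z => c * z)%C), cdiff_mult; [apply cdiff_const |
      apply cdiff_id]|].
  cbv beta. ring.
Qed.

Lemma cdiff_exp_inv (c x : C) :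
  x <> RtoC 0 -> cdiff (fun z => Cexp (- (c / z)))%C x (c / x ^ 2 * Cexp (- (c / x)))%C.
Proof.
  intros Hx.
  eapply (cdiff_ext (fun z => Cexp ((- c) * / z))%C); [intros z; f_equal; unfold Cdiv; ring|].
  eapply cdiff_eq.
  - apply (cdiff_exp_comp (fun z => (- c) * / z)%C), cdiff_mult; [apply cdiff_const | apply
      cdiff_inv, Hx].
  - cbv beta. replace ((- c) * / x)%C with (- (c / x))%C by (unfold Cdiv; ring). field. exact Hx.
Qed.

Lemma Lop_intro (a y : C -> C) (x v dy : C) :
  cdiff y x dy -> (dy - a x * y x)%C = v -> is_Lop a y x v.
Proof. intros H E. exists dy. split; [apply cdiff_is_derive, H | exact E]. Qed.

Lemma Phi0_fundamental (beta1 beta2 gamma1 gamma2 : C) (theta : R) :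
  beta1 <> beta2 -> ~ singular_direction0 beta1 beta2 theta ->
  is_fundamental_matrix beta1 beta2 gamma1 gamma2
    (dom0 gamma1 gamma2 theta) (Phi0 beta1 beta2 gamma1 gamma2 theta).
Proof.
  intros Hb Hsing.
  assert (Hb0 : (beta2 - beta1)%C <> RtoC 0) by (apply Cminus_eq_contra; auto).
  assert (N : exists x, dom0 gamma1 gamma2 theta x).
  (* At x = s e^(i theta) the quotient e^(i theta)/x is the real number 1/s = |g| + 1. *)
  { set (s := / (Cmod (gamma2 - gamma1)%C + 1)). pose proof (Cmod_ge_0 (gamma2 - gamma1)%C).
    assert (Hs : 0 < s) by (apply Rinv_0_lt_compat; lra).
    assert (Hs0 : RtoC s <> RtoC 0) by (intros X; apply RtoC_inj in X; lra).
    exists (RtoC s * Cexp (Ci * RtoC theta))%C. split.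
    - apply Cmult_neq_0; [exact Hs0 | apply Cexp_nz].
    - replace (Cexp (Ci * RtoC theta) / (RtoC s * Cexp (Ci * RtoC theta)))%C with (RtoC (/ s)).
      + unfold s. rewrite Rinv_inv. simpl. lra.
      + rewrite RtoC_inv by lra. field. split; [apply Cexp_nz | exact Hs0]. }
  assert (E : forall x i j, (i < 2)%nat -> (j < 2)%nat ->
    coeff_mat (RtoC 0) (Phi0 beta1 beta2 gamma1 gamma2 theta x) i j
    = match i, j with
      | O, O => (Cexp (gamma1 * x) * Cexp (- (beta1 / x)))%C
      | O, _ => (Cexp (gamma1 * x) * (x ^ 2 / (beta2 - beta1)
          + (gamma2 - gamma1) * x ^ 2 * phi0 beta1 beta2 gamma1 gamma2 theta x)
          * / x ^ 2 * Cexp (- (beta2 / x)))%C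
      | _, O => RtoC 0
      | _, _ => (Cexp (gamma2 * x) * / x ^ 2 * Cexp (- (beta2 / x)))%C
      end).
  { intros x i j Hi Hj. rewrite Phi0_entries. unfold M2. rewrite coeff_mat_bij by assumption.
      reflexivity. }
  split; [|split].
  - intros x Hx. pose proof Hx as [Hx0 _].
    split; [|split; [|split]].
    + rewrite E by lia. reflexivity.
    + eapply Lop_intro.
      * eapply cdiff_ext; [intros z; symmetry; apply E; lia|].
        apply cdiff_mult; [apply cdiff_exp_lin | apply cdiff_exp_inv, Hx0].
      * cbv beta. rewrite E by lia. unfold coefL1. field. exact Hx0.
    + eapply Lop_intro.
      * eapply cdiff_ext; [intros z; symmetry; apply E; lia|].
        apply cdiff_mult; [apply cdiff_mult; [apply cdiff_exp_lin | apply cdiff_inv_sqr, Hx0] |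
            apply cdiff_exp_inv, Hx0].
      * cbv beta. rewrite E by lia. unfold coefL2. field. exact Hx0.
    + destruct (phi0_cdiff beta1 beta2 gamma1 gamma2 theta x Hb Hsing Hx) as (dphi & Hd & Ed).
      eapply Lop_intro.
      * eapply cdiff_ext; [intros z; symmetry; apply E; lia|].
        apply cdiff_mult; [apply cdiff_mult; [apply cdiff_mult|]|].
        -- apply cdiff_exp_lin.
        -- apply cdiff_plus.
           ++ apply cdiff_mult; [apply cdiff_sqr | apply cdiff_const].
           ++ apply cdiff_mult; [apply cdiff_mult; [apply cdiff_const | apply cdiff_sqr] | exact Hd].
        -- apply cdiff_inv_sqr, Hx0.
        -- apply cdiff_exp_inv, Hx0.
      * cbv beta. rewrite !E by lia. unfold coefL1.
        (* L1 of the entry is e^(gamma1 x) x^(-2) e^(-beta2/x) times 1 + g (x^2 phi' - b phi), where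
           the 1 comes from the term x^2/(beta2 - beta1) of [H0]. By the equation for phi this
           factor is e^(g x). *)
        assert (Eg : Cexp (gamma2 * x)%C = (Cexp (gamma1 * x) * (RtoC 1 +
          (gamma2 - gamma1) * (x ^ 2 * dphi - (beta1 - beta2) * phi0 beta1 beta2 gamma1 gamma2
              theta x)))%C).
        { rewrite Ed. replace (RtoC 1 + (Cexp ((gamma2 - gamma1) * x) - RtoC 1))%C
            with (Cexp ((gamma2 - gamma1) * x)) by ring.
          rewrite <- Cexp_plus. f_equal. ring. }
        rewrite Eg. field. split; assumption.
  - destruct N as [x Hx]. exists x. split; [exact Hx|]. rewrite E by lia.
    apply Cmult_neq_0; apply Cexp_nz.
  - destruct N as [x Hx]. exists x. split; [exact Hx|]. rewrite E by lia.
    destruct Hx as [Hx0 _].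
    apply Cmult_neq_0; [apply Cmult_neq_0|]; try apply Cexp_nz.
    intros X. apply C1_nz. rewrite <- (Cinv_r (x ^ 2)%C (Cpow_nz _ _ Hx0)), X. ring.
Qed.

(** * The Stokes matrix *)

Lemma CSeries_ext_opp (a b : nat -> C) :
  (forall n, a n = (- b n)%C) -> CSeries a = (- CSeries b)%C.
Proof.
  intros H. unfold CSeries. apply C_ext; simpl; rewrite <- Series_opp;
    apply Series_ext; intros n; rewrite H; reflexivity.
Qed.

(** The alternating sign turns powers of beta2 - beta1 into powers of the pole beta1 - beta2, and
    one sign is left over. *)
Lemma S0_ufun (beta1 beta2 gamma1 gamma2 : C) :
  S0 beta1 beta2 gamma1 gamma2 = (- ufun (gamma2 - gamma1) (beta1 - beta2))%C.
Proof.
  apply CSeries_ext_opp. intros n.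
  replace (beta1 - beta2)%C with ((- RtoC 1) * (beta2 - beta1))%C by ring.
  rewrite Cpow_mult_l, Cpow_add_r, Cpow_1_r. unfold ucoef, Cdiv. ring.
Qed.

(** Singular directions differ by multiples of 2 pi, and 0 < eps < pi/2 is too small for that. The
    sign s treats both sides at once. *)
Lemma neighbours_nonsingular (beta1 beta2 : C) (theta eps s : R) :
  singular_direction0 beta1 beta2 theta -> 0 < eps < PI / 2 -> s = 1 \/ s = -1 ->
  beta1 <> beta2 -> ~ singular_direction0 beta1 beta2 (theta + s * eps).
Proof.
  intros H He Hs Hb H'. apply singular_direction0_iff in H as [k Hk]; [|exact Hb].
  apply singular_direction0_iff in H' as [l Hl]; [|exact Hb].
  pose proof PI_RGT_0.
  assert (E : s * eps = 2 * IZR (l - k) * PI) by (rewrite minus_IZR; lra).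
  destruct (Z.eq_dec (l - k) 0) as [E0 | E0].
  - rewrite E0 in E. destruct Hs; subst s; lra.
  - assert (1 <= Rabs (IZR (l - k))).
    { rewrite <- abs_IZR. apply IZR_le. lia. }
    assert (Rabs (s * eps) = eps).
    { rewrite Rabs_mult, (Rabs_pos_eq eps) by lra.
      destruct Hs; subst s; [rewrite Rabs_R1 | rewrite (Rabs_left (-1)) by lra]; ring. }
    rewrite E, !Rabs_mult, (Rabs_pos_eq 2), (Rabs_pos_eq PI) in H1 by lra. nra.
Qed.

(** The two matrices differ only in the upper right entry. The product of the inverse of one with
    the other has there the difference of these entries over the common upper left entry, namely g
    e^(b/x) times the jump of phi. *)
Lemma Phi0_Stokes (beta1 beta2 gamma1 gamma2 : C) (theta : R) :
  beta1 <> beta2 -> singular_direction0 beta1 beta2 theta ->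
  is_Stokes0 beta1 beta2 gamma1 gamma2 theta
    (M2 (RtoC 1)
        (- RtoC 2 * RtoC PI * Ci * (gamma2 - gamma1) * S0 beta1 beta2 gamma1 gamma2)%C
        (RtoC 0) (RtoC 1)).
Proof.
  intros Hb Hsing. pose proof PI_RGT_0 as HPI.
  (* For eps < pi/2 the cosine is positive: the triangle can reach beyond the pole, and the two
     half-planes for 1/x intersect. *)
  exists (PI / 2). split; [lra|]. intros eps He.
  assert (Hc : 0 < cos eps) by (apply cos_gt_0; lra).
  set (g := (gamma2 - gamma1)%C). set (b := (beta1 - beta2)%C).
  pose proof (Cmod_ge_0 g) as Hg0.
  set (e0 := Cexp (Ci * RtoC theta)%C).
  assert (He0 : Cmod e0 = 1) by apply Cmod_Cexp_i.
  split.
  (* With x = s e^(i theta) both real parts equal cos eps / s, and s is chosen to make this |g| +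
     1. *)
  - set (s := cos eps / (Cmod g + 1)).
    assert (Hs : 0 < s) by (apply Rdiv_lt_0_compat; lra).
    assert (Hs0 : RtoC s <> RtoC 0) by (intros X; apply RtoC_inj in X; lra).
    assert (Hx0 : (RtoC s * e0)%C <> RtoC 0) by (apply Cmult_neq_0; [exact Hs0 | apply Cexp_nz]).
    assert (Hcs : cos eps / s = Cmod g + 1) by (unfold s; field; lra).
    exists (RtoC s * e0)%C. unfold dom0. rewrite Cexp_i_plus, Cexp_i_minus. fold e0. fold g.
    split; (split; [exact Hx0|]).
    + replace (Re _) with (cos eps / s); [lra|].
      replace (e0 * (RtoC (cos eps) + Ci * RtoC (sin eps)) / (RtoC s * e0))%C
        with (RtoC (/ s) * (RtoC (cos eps) + Ci * RtoC (sin eps)))%C.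
      * rewrite re_scal_l. simpl. field. lra.
      * rewrite RtoC_inv by lra. field. split; [apply Cexp_nz | exact Hs0].
    + replace (Re _) with (cos eps / s); [lra|].
      replace (e0 * (RtoC (cos eps) - Ci * RtoC (sin eps)) / (RtoC s * e0))%C
        with (RtoC (/ s) * (RtoC (cos eps) - Ci * RtoC (sin eps)))%C.
      * rewrite re_scal_l. simpl. field. lra.
      * rewrite RtoC_inv by lra. field. split; [apply Cexp_nz | exact Hs0].
  - intros x [Hx Hp] [_ Hm].
    assert (Np := neighbours_nonsingular beta1 beta2 theta eps 1 Hsing He (or_introl eq_refl) Hb).
    assert (Nm := neighbours_nonsingular beta1 beta2 theta eps (-1) Hsing He (or_intror eq_refl) Hb).
    replace (theta + 1 * eps) with (theta + eps) in Np by ring.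
    replace (theta + -1 * eps) with (theta - eps) in Nm by ring.
    assert (Rp := ray_avoids beta1 beta2 _ Hb Np). assert (Rm := ray_avoids beta1 beta2 _ Hb Nm).
    fold b in Rp, Rm. fold g in Hp, Hm.
    assert (Vp : exists l, cimp (fun t => ufun g (RtoC t * Cexp (Ci * RtoC (theta + eps)))
       * kern (Cexp (Ci * RtoC (theta + eps))) (/ x) b t)%C l).
    { destruct (cimp_kern (Cexp (Ci * RtoC (theta + eps))) (/ x)%C b (Cmod_Cexp_i _)
        (Rle_lt_trans _ _ _ Hg0 Hp) Rp) as [J HJ].
      destruct (cimp_ufun_kern g _ _ b J (Cmod_Cexp_i _) Hp Rp HJ) as (l & Hl & _). exists l; exact Hl. }
    assert (Vm : exists l, cimp (fun t => ufun g (RtoC t * Cexp (Ci * RtoC (theta - eps)))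
       * kern (Cexp (Ci * RtoC (theta - eps))) (/ x) b t)%C l).
    { destruct (cimp_kern (Cexp (Ci * RtoC (theta - eps))) (/ x)%C b (Cmod_Cexp_i _)
        (Rle_lt_trans _ _ _ Hg0 Hm) Rm) as [J HJ].
      destruct (cimp_ufun_kern g _ _ b J (Cmod_Cexp_i _) Hm Rm HJ) as (l & Hl & _). exists l; exact Hl. }
    destruct Vp as [lp Hlp]. destruct Vm as [lm Hlm].
    assert (Ep := phi0_value beta1 beta2 gamma1 gamma2 (theta + eps) x lp Hlp).
    assert (Em := phi0_value beta1 beta2 gamma1 gamma2 (theta - eps) x lm Hlm).
    destruct Hsing as (r & Hr & Er). unfold laplace_den in Er. fold e0 in Er.
    assert (Eb : b = (RtoC r * e0)%C).
    { symmetry. apply Ceq_minus. rewrite <- Er. unfold b. ring. }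
    assert (J : (lm - lp = ufun g b * (RtoC 2 * Ci * RtoC PI * Cexp (- (b * / x))))%C).
    { rewrite Cexp_i_plus in Hlp, Hp. rewrite Cexp_i_minus in Hlm, Hm. rewrite Eb in *.
      exact (stokes_ufun g e0 (/ x)%C r eps lm lp He0 Hr He Hm Hp Hlm Hlp). }
    rewrite !Phi0_entries, Ep, Em, S0_ufun. fold g. fold b.
    set (A := Cexp (gamma1 * x)%C). set (B1 := Cexp (- (beta1 / x))%C). set (B2 := Cexp (- (beta2 /
        x))%C).
    set (G := Cexp (gamma2 * x)%C).
    assert (HA : A <> RtoC 0) by apply Cexp_nz. assert (HG : G <> RtoC 0) by apply Cexp_nz.
    assert (HB1 : B1 <> RtoC 0) by apply Cexp_nz. assert (HB2 : B2 <> RtoC 0) by apply Cexp_nz.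
    (* As b = beta1 - beta2, the exponential of the jump exactly compensates the ratio of the two
       diagonal exponentials; here the dependence on x disappears. *)
    assert (HbB : (Cexp (- (b * / x)) * B2)%C = B1).
    { unfold B1, B2. rewrite <- Cexp_plus. f_equal. unfold b, Cdiv. ring. }
    assert (Hb0 : (beta2 - beta1)%C <> RtoC 0) by (apply Cminus_eq_contra; auto).
    set (q := fun l => (A * (x ^ 2 / (beta2 - beta1) + g * x ^ 2 * l) * / x ^ 2 * B2)%C).
    set (D := (G * / x ^ 2 * B2)%C).
    assert (HD : D <> RtoC 0).
    { unfold D. apply Cmult_neq_0; [apply Cmult_neq_0|]; try assumption.
      intros X. apply C1_nz. rewrite <- (Cinv_r (x ^ 2)%C (Cpow_nz _ _ Hx)), X. ring. }
    change (A * (x ^ 2 / (beta2 - beta1) + g * x ^ 2 * lp) * / x ^ 2 * B2)%C with (q lp).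
    change (A * (x ^ 2 / (beta2 - beta1) + g * x ^ 2 * lm) * / x ^ 2 * B2)%C with (q lm).
    (* The inverse of the upper triangular matrix with diagonal A B1, D and upper right entry
       [q lp]. *)
    exists (M2 (/ (A * B1)) (- (q lp / (A * B1 * D))) (RtoC 0) (/ D))%C.
    unfold is_inv2. rewrite !mul2_M2, Mone_M2.
    assert (Hq : (q lm - q lp = A * B2 * g * (lm - lp))%C).
    { unfold q. field. split; [exact Hx | exact Hb0]. }
    repeat split.
    + f_equal; field; repeat split; assumption.
    + f_equal; field; repeat split; assumption.
    + f_equal; try (field; repeat split; assumption).
      replace (/ (A * B1) * q lm + - (q lp / (A * B1 * D)) * D)%C with ((q lm - q lp) / (A * B1))%C
        by (field; repeat split; assumption).
      rewrite Hq, J, <- HbB. field. repeat split; try assumption. apply Cexp_nz.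
Qed.

Theorem theorem3p11 (beta1 beta2 gamma1 gamma2 : C) (hbeta : beta1 <> beta2) :
  (forall theta : R,
     ~ (exists k : Z, theta = Arg (beta1 - beta2)%C + 2 * IZR k * PI) ->
     is_fundamental_matrix beta1 beta2 gamma1 gamma2
       (dom0 gamma1 gamma2 theta) (Phi0 beta1 beta2 gamma1 gamma2 theta)) /\
  (forall theta : R,
     singular_direction0 beta1 beta2 theta <->
     exists k : Z, theta = Arg (beta1 - beta2)%C + 2 * IZR k * PI) /\
  (forall theta : R,
     singular_direction0 beta1 beta2 theta ->
     is_Stokes0 beta1 beta2 gamma1 gamma2 theta
       (M2 (RtoC 1)
           (- RtoC 2 * RtoC PI * Ci * (gamma2 - gamma1)
              * S0 beta1 beta2 gamma1 gamma2)%C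
           (RtoC 0)
           (RtoC 1))).
Proof.
  split; [|split].
  - intros theta H. apply Phi0_fundamental; [exact hbeta|].
    rewrite singular_direction0_iff by exact hbeta. exact H.
  - intros theta. apply singular_direction0_iff, hbeta.
  - intros theta H. apply Phi0_Stokes; assumption.
Qed.
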